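(* Let $(R,\mu,A)$ be an averaging algebra over a field $\mathbf k$ and let $\alpha=(m,\tau)$ be the corresponding Maurer–Cartan element in the $L_\infty$-algebra $\mathcal C_{AvA}(R)$. Then the underlying complex of the $L_\infty$-algebra $(\mathcal C_{AvA}(R),\{l_n^\alpha\}_{n\ge1})$ is exactly the cochain complex $sC^\bullet_{\mathrm{AvA}}(R)$, the shift of the cochain complex $C^\bullet_{\mathrm{AvA}}(R)$ of the averaging algebra $(R,\mu,A)$.
   Context: **Averaging algebras and their complex.** $\mathbf k$ is a field. An averaging algebra $(R,\mu,A)$ is an associative algebra $R$ with multiplication $\mu$ (written $xy$) and a linear map $A:R\to R$ with $A(x)A(y)=A(xA(y))=A(A(x)y)$. Let $C^n_{\mathrm{Alg}}(R)=\mathrm{Hom}(R^{\otimes n},R)$ with Hochschild differential $\delta f(x_1\otimes\cdots\otimes x_{n+1})=x_1f(x_2\otimes\cdots\otimes x_{n+1})+\sum_{i=1}^n(-1)^if(\cdots\otimes x_ix_{i+1}\otimes\cdots)+(-1)^{n+1}f(x_1\otimes\cdots\otimes x_n)x_{n+1}$ (for $n=0$, $\delta(m)(r)=rm-mr$). Let $C^0_{\mathrm{AvO}}(R)=\mathrm{Hom}(\mathbf k,R)=R$, $C^1_{\mathrm{AvO}}(R)=\mathrm{Hom}(R,R)$, and $C^n_{\mathrm{AvO}}(R)=C^n_r\oplus C^n_l$ with $C^n_r=C^n_l=\mathrm{Hom}(R^{\otimes n},R)$ for $n\ge2$. Its differential $\partial$ is: in degree $0$, $\partial_0(m)(r)=A(mr)-A(rm)-mA(r)+A(r)m$;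 in degree $1$, $f\mapsto(\partial_rf,\partial_lf)$; in degree $n\ge2$, $(f,g)\mapsto(\partial_rf,\partial_lg)$; where $\partial_rf(x_1\otimes\cdots\otimes x_{n+1})=A(x_1)f(x_2\otimes\cdots\otimes x_{n+1})-A(x_1f(x_2\otimes\cdots\otimes x_{n+1}))+\sum_{i=1}^n(-1)^if(\cdots\otimes x_iA(x_{i+1})\otimes\cdots)+(-1)^{n+1}f(x_1\otimes\cdots\otimes x_n)A(x_{n+1})$, $\partial_lg(x_1\otimes\cdots\otimes x_{n+1})=A(x_1)g(x_2\otimes\cdots\otimes x_{n+1})+\sum_{i=1}^n(-1)^ig(\cdots\otimes A(x_i)x_{i+1}\otimes\cdots)+(-1)^{n+1}g(x_1\otimes\cdots\otimes x_n)A(x_{n+1})+(-1)^nA(g(x_1\otimes\cdots\otimes x_n)x_{n+1})$. Let $\Phi^0=\mathrm{id}$, $\Phi^1(f)=f\circ A-A\circ f$, and for $n\ge2$, $\Phi^n(f)=(\Phi^n_r(f),\Phi^n_l(f))$ with $\Phi^n_r(f)=f\circ A^{\otimes n}-A\circ f\circ(\mathrm{id}\otimes A^{\otimes n-1})$, $\Phi^n_l(f)=f\circ A^{\otimes n}-A\circ f\circ(A^{\otimes n-1}\otimes\mathrm{id})$. $C^n_{\mathrm{AvA}}(R)=C^n_{\mathrm{Alg}}(R)\oplus C^{n-1}_{\mathrm{AvO}}(R)$ (with $C^{-1}_{\mathrm{AvO}}=0$), with differential $d(f,g)=(\delta f,\ (-1)^n\Phi^n(f)+\partial g)$ in degree $n$.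 **$L_\infty$-algebras.** For homogeneous $x_1,\dots,x_n$ and $\sigma\in S_n$, $\chi(\sigma;x_1,\dots,x_n)=\mathrm{sgn}(\sigma)\epsilon(\sigma;x_1,\dots,x_n)$ with $\epsilon$ the Koszul sign defined by $x_1\cdots x_n=\epsilon\,x_{\sigma(1)}\cdots x_{\sigma(n)}$ in the free graded commutative algebra. An $L_\infty$-algebra is a graded space $L$ with operations $l_n:L^{\otimes n}\to L$ of degree $n-2$, graded antisymmetric (with sign $\chi$) and satisfying $\sum_{i=1}^n\sum_{\sigma\in S(i,n-i)}\chi(\sigma;x_1,\dots,x_n)(-1)^{i(n-i)}l_{n-i+1}(l_i(x_{\sigma(1)}\otimes\cdots\otimes x_{\sigma(i)})\otimes x_{\sigma(i+1)}\otimes\cdots\otimes x_{\sigma(n)})=0$ for all $n\ge1$ (sum over $(i,n-i)$-shuffles). A Maurer–Cartan element is $\alpha\in L_{-1}$ with $\sum_{n\ge1}\frac1{n!}(-1)^{n(n-1)/2}l_n(\alpha^{\otimes n})=0$. It defines a new $L_\infty$-structure on $L$ by $l^\alpha_n(x_1\otimes\cdots\otimes x_n)=\sum_{i\ge0}\frac1{i!}(-1)^{in+\frac{i(i+1)}2+\sum_{k=1}^{n-1}\sum_{j=1}^k|x_j|}\,l_{n+i}(\alpha^{\otimes i}\otimes x_1\otimes\cdots\otimes x_n)$; its underlying complex is $(L,l_1^\alpha)$. **The $L_\infty$-algebra $\mathcal C_{AvA}(V)$** for a graded space $V$; here $V=R$ in degree $0$. $sV$ is the suspension, $(sV)_n=V_{n-1}$;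 $T^c(sV)=\bigoplus_{n\ge0}(sV)^{\otimes n}$; $\mathrm{Hom}$ is graded Hom. As a graded space $\mathcal C_{AvA}(V)=\mathcal C_A(V)\oplus\mathrm{Hom}(\mathbf k,V)\oplus\mathrm{Hom}(sV,V)\oplus\mathcal C_{AvO}(V)_l^{\ge2}\oplus\mathcal C_{AvO}(V)_r^{\ge2}$, where $\mathcal C_A(V)=\mathrm{Hom}(T^c(sV),sV)$ and $\mathcal C_{AvO}(V)_l^{\ge2}$, $\mathcal C_{AvO}(V)_r^{\ge2}$ are two copies of $\mathrm{Hom}(\bigoplus_{n\ge2}(sV)^{\otimes n},V)$. Put $\mathcal C_{AvO}(V)_{r}=\mathrm{Hom}(\mathbf k,V)\oplus\mathrm{Hom}(sV,V)\oplus\mathcal C_{AvO}(V)_{r}^{\ge2}$, and similarly $\mathcal C_{AvO}(V)_l$. Elements of $\mathcal C_A(V)$ are written $sh$ with $h\in\mathrm{Hom}(T^c(sV),V)$, $(sh)(w)=s(h(w))$, $|sh|=|h|+1$; likewise $sg$ for $g\in\mathrm{Hom}((sV)^{\otimes n},V)$. $f\circ(g_1\otimes\cdots\otimes g_n)$ is the usual composition with Koszul signs. For $f$ on $(sV)^{\otimes n}$ and $g\in\mathrm{Hom}((sV)^{\otimes k},sV)$, $(f\bar\circ g)(w_1\otimes\cdots\otimes w_{n+k-1})=\sum_{i=0}^{n-1}(-1)^{|g|(|w_1|+\cdots+|w_i|)}f(w_1\otimes\cdots\otimes w_i\otimes g(w_{i+1}\otimes\cdots\otimes w_{i+k})\otimes\cdots\otimes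 w_{n+k-1})$, and $[f,g]_G=f\bar\circ g-(-1)^{|f||g|}g\bar\circ f$ on $\mathcal C_A(V)$. Operations (for homogeneous elements of a single arity, extended multilinearly): (I) $l_1(sh)=h$ for $sh\in\mathrm{Hom}(\mathbf k,sV)$; $l_1$ vanishes elsewhere. (II) $l_2(sg\otimes sh)=[sg,sh]_G$ on $\mathcal C_A(V)$. (III) For $sh\in\mathrm{Hom}((sV)^{\otimes n},sV)$, $n\ge1$, and $g_1,\dots,g_n\in\mathcal C_{AvO}(V)_r$: put $(-1)^\varepsilon=\chi(\sigma;g_1,\dots,g_n)(-1)^{n(|h|+1)+\sum_{k=1}^{n-1}\sum_{j=1}^k|g_{\sigma(j)}|}$, let $p$ be the integer such that $g_{\sigma(1)},\dots,g_{\sigma(p-1)}\in\mathrm{Hom}(\mathbf k,V)$ and $g_{\sigma(p)}\in\mathrm{Hom}(sV,V)\oplus\mathcal C_{AvO}(V)_r^{\ge2}$ (so $p=1$ if no $g_i$ lies in $\mathrm{Hom}(\mathbf k,V)$; if all $g_i\in\mathrm{Hom}(\mathbf k,V)$ no such $p$ exists, but such brackets do not enter $l_1^\alpha$ below), and $l^r_{n+1}(sh\otimes g_1\otimes\cdots\otimes g_n)=\sum_{\sigma\in S_n}(-1)^\varepsilon\Big(h\circ(sg_{\sigma(1)}\otimes\cdots\otimes sg_{\sigma(n)})-(-1)^{(|g_{\sigma(p)}|+1)(|h|+1+\sum_{k=1}^{p-1}(|g_{\sigma(k)}|+1))}g_{\sigma(p)}\bar\circ\big(sh\circ(sg_{\sigma(1)}\otimes\cdots\otimes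 sg_{\sigma(p-1)}\otimes\mathrm{id}_{sV}\otimes sg_{\sigma(p+1)}\otimes\cdots\otimes sg_{\sigma(n)})\big)\Big)$ in $\mathcal C_{AvO}(V)_r$. (IV) For $g_1,\dots,g_n\in\mathcal C_{AvO}(V)_l$, $l^l_{n+1}(sh\otimes g_1\otimes\cdots\otimes g_n)\in\mathcal C_{AvO}(V)_l$ is given by the same formula with $p$ replaced by the integer $q$ such that $g_{\sigma(q+1)},\dots,g_{\sigma(n)}\in\mathrm{Hom}(\mathbf k,V)$ and $g_{\sigma(q)}\in\mathrm{Hom}(sV,V)\oplus\mathcal C_{AvO}(V)_l^{\ge2}$ (so $q=n$ if no $g_i$ lies in $\mathrm{Hom}(\mathbf k,V)$). (V) If all $g_i\in\mathrm{Hom}(\mathbf k,V)\oplus\mathrm{Hom}(sV,V)$: with at most one in $\mathrm{Hom}(sV,V)$, $l^r_{n+1}$ and $l^l_{n+1}$ coincide and $l_{n+1}:=l^r_{n+1}=l^l_{n+1}$; with at least two in $\mathrm{Hom}(sV,V)$, $l_{n+1}:=(l^r_{n+1},l^l_{n+1})\in\mathcal C_{AvO}(V)_r^{\ge2}\oplus\mathcal C_{AvO}(V)_l^{\ge2}$. If all $g_i\in\mathcal C_{AvO}(V)_r$ and some $g_i\in\mathcal C_{AvO}(V)_r^{\ge2}$, $l_{n+1}:=l^r_{n+1}$; if all $g_i\in\mathcal C_{AvO}(V)_l$ and some $g_i\in\mathcal C_{AvO}(V)_l^{\ge2}$, $l_{n+1}:=l^l_{n+1}$. (VI) $l_{n+1}(g_1\otimes\cdots\otimes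 g_i\otimes sh\otimes g_{i+1}\otimes\cdots\otimes g_n)=(-1)^{(|h|+1)\sum_{k=1}^i|g_k|+i}l_{n+1}(sh\otimes g_1\otimes\cdots\otimes g_n)$; the $l_n$ vanish elsewhere. **The Maurer–Cartan element and the identification.** Regard $R$ as a graded space concentrated in degree $0$. The Maurer–Cartan element corresponding to $(R,\mu,A)$ is $\alpha=(m,\tau)\in\mathrm{Hom}((sR)^{\otimes2},sR)\oplus\mathrm{Hom}(sR,R)$ with $m(sa\otimes sb)=s\mu(a\otimes b)$, $\tau(sa)=A(a)$. In the statement $\mathcal C_A(R)$ is identified with $C^\bullet_{\mathrm{Alg}}(R)$, and $\mathrm{Hom}(\mathbf k,R)\oplus\mathrm{Hom}(sR,R)\oplus\mathcal C_{AvO}(R)_r^{\ge2}\oplus\mathcal C_{AvO}(R)_l^{\ge2}$ with $C^\bullet_{\mathrm{AvO}}(R)$.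
   Formalization: Since the twisted operations involve 1/i!, equality of the differentials in degree n is stated only when max(n,2)! is nonzero in the field (always so in characteristic 0); maps of arity n are identified up to the sign (-1)^{(n-1)(n-2)/2}. *)

(* Defs.v *)
From HB Require Import structures.
From mathcomp Require Import all_boot all_order all_algebra all_fingroup.
From mathcomp Require Import all_classical.

Set Implicit Arguments.
Unset Strict Implicit.
Unset Printing Implicit Defensive.
Import Order.TTheory GRing.Theory Num.Theory.

Local Open Scope classical_set_scope.
Local Open Scope ring_scope.

(** * L-infinity operations: Maurer-Cartan elements and twisting *)

Section Linfty.
Variables (k : fieldType) (L : lmodType k).

(* A family of operations (l_n) on a graded space is given on homogeneous
   elements: its argument is the list of the pairs (|x_j|, x_j), and n is the
   length of that list. *)
Definition operations := seq (int * L) -> L.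

(* Sums over all natural numbers of families with finitely many nonzero terms. *)
Definition sums_to (u : nat -> L) (y : L) : Prop :=
  exists n, forall m, (n <= m)%N -> \sum_(i < m) u i = y.

Definition maurer_cartan (grade : int -> set L) (l : operations) (alpha : L) :=
  grade (-1) alpha /\
  sums_to (fun n => if n == 0%N then 0 else
    ((n`!)%:R^-1 * (-1) ^+ 'C(n, 2)) *: l (nseq n (-1, alpha))) 0.

Definition twist_sign (i : nat) (xs : seq (int * L)) : int :=
  (i * size xs + 'C(i.+1, 2))%N%:Z
  + \sum_(1 <= m < size xs) \sum_(j < m) (nth (0, 0) xs j).1.

(* [twisted l alpha xs y] : the value l^alpha_n(x_1, ..., x_n) is y. *)
Definition twisted (l : operations) (alpha : L) (xs : seq (int * L)) (y : L) :=
  sums_to (fun i =>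
    ((i`!)%:R^-1 * (-1) ^ twist_sign i xs) *: l (nseq i (-1, alpha) ++ xs)) y.

End Linfty.

(** * Multilinear maps

   A word x_1 ... x_n in R stands both for x_1 (x) ... (x) x_n and for
   sx_1 (x) ... (x) sx_n.  A linear map on R^{(x) n} (or on (sR)^{(x) n}) is
   the corresponding multilinear function on words of length n, extended by 0
   to the words of any other length; a value y : R stands for y or for sy,
   according to the target.  *)

Section Multilinear.
Variables (k : fieldType) (R : lmodType k).

Definition hom (n : nat) : set (seq R -> R) :=
  [set f | (forall w, size w != n -> f w = 0) /\
           (forall u v (a : k) x y, (size u + size v).+1 = n ->
              f (u ++ (a *: x + y) :: v) = a *: f (u ++ x :: v) + f (u ++ y :: v))].

Definition unary (A : R -> R) (w : seq R) : R :=
  if w is [:: x] then A x else 0.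
Definition binary (mu : R -> R -> R) (w : seq R) : R :=
  if w is [:: x; y] then mu x y else 0.

End Multilinear.

(** * The cochain complex of an averaging algebra *)

Definition averaging_algebra (k : fieldType) (R : lmodType k)
    (mu : {bilinear R -> R -> R}) (A : {linear R -> R}) : Prop :=
  [/\ forall x y z, mu (mu x y) z = mu x (mu y z),
      forall x y, mu (A x) (A y) = A (mu x (A y)) &
      forall x y, A (mu x (A y)) = A (mu (A x) y)].

Section AveragingComplex.
Variables (k : fieldType) (R : lmodType k).
Variables (mu : R -> R -> R) (A : R -> R).

Local Notation cochain := (seq R -> R).
Local Notation "x ** y" := (mu x y) (at level 40, left associativity).

(* x_1 ... x_n with the letters of (0-based) positions i and i+1 replaced by
   op x_{i+1} x_{i+2}. *)
Definition merge_at (op : R -> R -> R) (i : nat) (w : seq R) : seq R :=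
  take i w ++ op (nth 0 w i) (nth 0 w i.+1) :: drop i.+2 w.

Definition hochschild (n : nat) (f : cochain) : cochain := fun w =>
  if size w == n.+1 then
    head 0 w ** f (behead w)
    + \sum_(i < n) (-1 : k) ^+ i.+1 *: f (merge_at mu i w)
    + (-1 : k) ^+ n.+1 *: (f (take n w) ** last 0 w)
  else 0.

Definition partial0 (m : cochain) : cochain := fun w =>
  if w is [:: r] then
    let a := m [::] in A (a ** r) - A (r ** a) - a ** A r + A r ** a
  else 0.

Definition partial_r (n : nat) (f : cochain) : cochain := fun w =>
  if size w == n.+1 then
    A (head 0 w) ** f (behead w) - A (head 0 w ** f (behead w))
    + \sum_(i < n) (-1 : k) ^+ i.+1 *: f (merge_at (fun x y => x ** A y) i w)
    + (-1 : k) ^+ n.+1 *: (f (take n w) ** A (last 0 w))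
  else 0.

Definition partial_l (n : nat) (g : cochain) : cochain := fun w =>
  if size w == n.+1 then
    A (head 0 w) ** g (behead w)
    + \sum_(i < n) (-1 : k) ^+ i.+1 *: g (merge_at (fun x y => A x ** y) i w)
    + (-1 : k) ^+ n.+1 *: (g (take n w) ** A (last 0 w))
    + (-1 : k) ^+ n *: A (g (take n w) ** last 0 w)
  else 0.

(* id (x) A^{(x) n-1} and A^{(x) n-1} (x) id *)
Definition map_tail (w : seq R) : seq R :=
  if w is x :: w' then x :: map A w' else [::].
Definition map_belast (w : seq R) : seq R :=
  if w is x :: w' then rcons (map A (belast x w')) (last x w') else [::].

Definition Phi_r (f : cochain) : cochain := fun w => f (map A w) - A (f (map_tail w)).
Definition Phi_l (f : cochain) : cochain := fun w => f (map A w) - A (f (map_belast w)).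

(* The carrier of C^n_AvO; the pairs are (r-component, l-component). *)
Definition AvO (n : nat) : lmodType k :=
  match n with
  | 0 | 1 => cochain
  | _ => (cochain * cochain)%type
  end.

Definition C_AvO (n : nat) : set (AvO n) :=
  match n with
  | 0 => hom 0
  | 1 => hom 1
  | n'.+2 => hom n'.+2 `*` hom n'.+2
  end.

Definition partial (n : nat) : AvO n -> AvO n.+1 :=
  match n with
  | 0 => partial0
  | 1 => fun f => (partial_r 1 f, partial_l 1 f)
  | n'.+2 => fun fg => (partial_r n'.+2 fg.1, partial_l n'.+2 fg.2)
  end.

Definition Phi (n : nat) : cochain -> AvO n :=
  match n with
  | 0 => fun f => f
  | 1 => fun f w => f (map A w) - A (f w)
  | _ => fun f => (Phi_r f, Phi_l f)
  end.

Definition AvA (n : nat) : lmodType k :=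
  if n is n'.+1 then (cochain * AvO n')%type else cochain.

Definition C_AvA (n : nat) : set (AvA n) :=
  match n with
  | 0 => hom 0
  | n'.+1 => hom n'.+1 `*` C_AvO (n := n')
  end.

Definition d_AvA (n : nat) : AvA n -> AvA n.+1 :=
  match n with
  | 0 => fun f => (hochschild 0 f, Phi 0 f)
  | n'.+1 => fun fg =>
      (hochschild n'.+1 fg.1, (-1 : k) ^+ n'.+1 *: Phi n'.+1 fg.1 + partial fg.2)
  end.

End AveragingComplex.

Arguments C_AvO {k} R n.
Arguments C_AvA {k} R n.

(** * The graded space of the L-infinity algebra, for V = R in degree 0 *)

(* The summands Hom(T^c(sR), sR), Hom(k, R), Hom(sR, R),
   Hom((sR)^{(x) >= 2}, R)_r and Hom((sR)^{(x) >= 2}, R)_l. *)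
Variant summand := SA | SK | SV | Sr | Sl.

Definition ord_of_summand (s : summand) : 'I_5 :=
  inord match s with SA => 0 | SK => 1 | SV => 2 | Sr => 3 | Sl => 4 end.
Definition summand_of_ord (i : 'I_5) : summand :=
  nth SA [:: SA; SK; SV; Sr; Sl] i.
Lemma ord_of_summandK : cancel ord_of_summand summand_of_ord.
Proof. by case; rewrite /summand_of_ord inordK. Qed.
HB.instance Definition _ := Finite.copy summand (can_type ord_of_summandK).

Definition arity_ok (s : summand) (n : nat) : bool :=
  match s with
  | SA => true
  | SK => n == 0%N
  | SV => n == 1%N
  | Sr | Sl => (2 <= n)%N
  end.

(* Since R sits in degree 0, (sR)^{(x) n} sits in degree n, and the maps of
   arity n have degree 1 - n if they take values in sR, and -n if they take
   values in R. *)
Definition degree (s : summand) (n : nat) : int := (s == SA)%:Z - n%:Z.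

(* For d <= 0 or (s, d) = (SA, 1), the arity of the maps of degree d in s. *)
Definition arity (s : summand) (d : int) : nat := `|(s == SA)%:Z - d|%N.

Definition occurs (s : summand) (d : int) : bool :=
  arity_ok s (arity s d) && (degree s (arity s d) == d).

Section CAvA.
Variables (k : fieldType) (R : lmodType k).

Definition total : lmodType k := summand -> seq R -> R.

Definition grade (d : int) : set total :=
  [set x | forall s, if occurs s d then hom (arity s d) (x s) else x s = 0].

Definition inj (s : summand) (f : seq R -> R) : total :=
  fun s' => if s' == s then f else 0.

(* Homogeneous elements lying in one summand and having one arity. *)
Record mono := Mono { sec : summand; ar : nat; ev : seq R -> R }.

Definition mono0 : mono := Mono SK 0 0.

Definition deg (x : mono) : int := degree (sec x) (ar x).

(* [susp g] is sg; an element sh of Hom((sR)^{(x) n}, sR) and its desuspension h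
   have the same underlying function on words, and |h| + 1 = |sh|. *)
Definition susp (g : mono) : mono := Mono SA (ar g) (ev g).

Definition id_sV : mono := Mono SA 1 (head 0).

(** ** Compositions with Koszul signs *)

(* (g_1 (x) ... (x) g_n)(w^1 (x) ... (x) w^n) is
   (-1)^{sum_{i < j} |g_j| |w^i|} g_1(w^1) (x) ... (x) g_n(w^n). *)
Definition tensor_sign (gs : seq mono) : int :=
  \sum_(j < size gs) \sum_(i < j) deg (nth mono0 gs j) * (ar (nth mono0 gs i))%:Z.

(* f o (g_1 (x) ... (x) g_n), for f of arity n and g_i with values in sR. *)
Definition comp (f : mono) (gs : seq mono) : mono :=
  let ars := map ar gs in
  Mono (sec f) (sumn ars) (fun w =>
    if size w == sumn ars then
      ((-1 : k) ^ tensor_sign gs) *: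
        ev f [seq ev gb.1 gb.2 | gb <- zip gs (reshape ars w)]
    else 0).

(* f \bar\circ g, for g with values in sR. *)
Definition brace (f g : mono) (w : seq R) : R :=
  if size w == (ar f + ar g).-1 then
    \sum_(i < ar f) ((-1 : k) ^ (deg g * i%:Z)) *:
      ev f (take i w ++ ev g (take (ar g) (drop i w)) :: drop (i + ar g) w)
  else 0.

Definition gerstenhaber (f g : mono) (w : seq R) : R :=
  brace f g w - ((-1 : k) ^ (deg f * deg g)) *: brace g f w.

(** ** The operations *)

(* The sign epsilon with x_1 ... x_n = epsilon x_{s(1)} ... x_{s(n)} in the free
   graded commutative algebra, for |x_i| = d i: a factor (-1)^{|x||y|} for each
   pair of letters x, y whose order is exchanged. *)
Definition koszul_sign n (s : 'S_n) (d : 'I_n -> int) : k :=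
  \prod_(i < n) \prod_(j < n | (i < j)%N && (s j < s i)%N) (-1) ^ (d (s i) * d (s j)).

Definition chi n (s : 'S_n) (d : 'I_n -> int) : k :=
  (-1) ^+ (s : bool) * koszul_sign s d.

Definition permute (gs : seq mono) (s : 'S_(size gs)) : seq mono :=
  [seq nth mono0 gs (s i) | i <- enum 'I_(size gs)].

(* The common formula for l^r_{n+1}(sh, g_1, ..., g_n) and
   l^l_{n+1}(sh, g_1, ..., g_n); [pos] computes the 0-based version of p, resp. q,
   from the permuted list.  If all g_i are in Hom(k, R), then [pos] returns a
   position holding an element of arity 0, and the term in [brace] vanishes. *)
Definition bracket (pos : seq mono -> nat) (sh : mono) (gs : seq mono) (w : seq R) : R :=
  let n := size gs in
  \sum_(s : 'S_n)
    let gp := permute s in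
    let p := pos gp in
    let g := nth mono0 gp p in
    let eps := n%:Z * deg sh + \sum_(1 <= m < n) \sum_(j < m) deg (nth mono0 gp j) in
    let eta := (deg g + 1) * (deg sh + \sum_(j < p) (deg (nth mono0 gp j) + 1)) in
    (chi s (fun i => deg (nth mono0 gs i)) * (-1) ^ eps) *:
      (ev (comp sh (map susp gp)) w
       - ((-1) ^ eta) *:
           brace g (comp sh (map susp (take p gp) ++
                             id_sV :: map susp (drop p.+1 gp))) w).

Definition not_K (g : mono) : bool := sec g != SK.

Definition pos_r (gs : seq mono) : nat := find not_K gs.
Definition pos_l (gs : seq mono) : nat := (size gs - find not_K (rev gs)).-1.

Definition in_low (g : mono) := sec g \in [:: SK; SV].
Definition in_r (g : mono) := sec g \in [:: SK; SV; Sr].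
Definition in_l (g : mono) := sec g \in [:: SK; SV; Sl].

(* l_{n+1}(sh, g_1, ..., g_n) for n >= 1 and g_i outside Hom(T^c(sR), sR).  With
   at most one g_i in Hom(sR, R) and the others in Hom(k, R), the value is in
   Hom(k, R) or in Hom(sR, R), and the two brackets coincide. *)
Definition l_sh (sh : mono) (gs : seq mono) : total :=
  let lr := bracket pos_r sh gs in
  let ll := bracket pos_l sh gs in
  let nV := count (fun g => sec g == SV) gs in
  if all in_low gs then
    match nV with
    | 0 => inj SK lr
    | 1 => inj SV lr
    | _ => inj Sr lr + inj Sl ll
    end
  else if all in_r gs then inj Sr lr
  else if all in_l gs then inj Sl ll
  else 0.

Definition in_A (x : mono) : bool := sec x == SA.

(* l_{n+1}(g_1, ..., g_i, sh, g_{i+1}, ..., g_n) *)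
Definition l_mixed (xs : seq mono) : total :=
  let i := find in_A xs in
  let sh := nth mono0 xs i in
  let gs := take i xs ++ drop i.+1 xs in
  if (count in_A xs == 1%N) && (ar sh == size gs) then
    ((-1 : k) ^ (deg sh * (\sum_(g <- take i xs) deg g) + i%:Z)) *: l_sh sh gs
  else 0.

Definition l_mono (xs : seq mono) : total :=
  match xs with
  | [:: x] => if in_A x && (ar x == 0%N) then inj SK (ev x) else 0
  | [:: x; y] => if in_A x && in_A y then inj SA (gerstenhaber x y) else l_mixed xs
  | _ => l_mixed xs
  end.

(* Multilinear extension to elements of grade(d_1), ..., grade(d_n); an element
   of grade(d) is the sum of its components in the summands s such that
   [occurs s d]. *)
Definition component (s : summand) (dx : int * total) : mono :=
  Mono s (arity s dx.1) (dx.2 s).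

Definition l_AvA : operations total := fun xs =>
  \sum_(c : (size xs).-tuple summand | all2 (fun s dx => occurs s dx.1) c xs)
    l_mono [seq component sx.1 sx.2 | sx <- zip c xs].

(* alpha = (m, tau) *)
Definition alpha_AvA (mu : R -> R -> R) (A : R -> R) : total :=
  inj SA (binary mu) + inj SV (unary A).

(** ** The identification with the shift of the cochain complex *)

(* (-1)^{(n-1)(n-2)/2}, written so as to make sense for n = 0 *)
Definition id_sign (n : nat) : k := (-1) ^+ ('C(n.+1, 2)).+1.

Definition ident_AvO (n : nat) : AvO R n -> total :=
  match n with
  | 0 => fun g => inj SK g
  | 1 => fun g => inj SV g
  | _ => fun g => inj Sr g.1 + inj Sl g.2
  end.

(* (sC_AvA)_d = C^{1 - d}_AvA, with the differential of C_AvA: a cochain of degree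
   n in C_AvA corresponds to an element of degree 1 - n.  Maps of arity n, in C_Alg
   as well as in C_AvO, are identified up to the sign [id_sign n]; these signs
   depend on the arity because, for f of arity n, [m, sf]_G is (-1)^{n-1} times the
   Hochschild differential of f.  As id_sign 1 = id_sign 2 = 1, alpha corresponds
   to (mu, A). *)
Definition ident (n : nat) : AvA R n -> total :=
  match n with
  | 0 => fun f => id_sign 0 *: inj SA f
  | n'.+1 => fun fg => id_sign n'.+1 *: inj SA fg.1 + id_sign n' *: ident_AvO fg.2
  end.

End CAvA.

Arguments ident {k R} n.
Arguments l_AvA {k} R.
Arguments grade {k} R.
Arguments d_AvA {k R} mu A n.

(* Main.v *)
(* The multilinear extension of the operations evaluated at alpha^i and x is a sum
   over the choices of mu or tau in each copy of alpha.  For x = (f, g) with f of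
   arity n, only few choices survive, because l_(n+1)(sh, ...) requires h to have
   arity n:
   - l_1(f) if n = 0, which gives Phi^0;
   - l_2(mu, f) = [mu, f]_G, which is the Hochschild differential up to the sign
     (-1)^(n+1);
   - l_(n+1)(tau, ..., tau, f), whose n! permutations contribute equally (the sign
     chi of a permutation of elements of degree -1 is 1), giving n! Phi^n(f);
   - l_3(mu, tau, g) and l_3(tau, mu, g), which are equal and give partial(g); the two
     permutations of (tau, g) give the two halves of the formula for partial.
   The Maurer-Cartan equation is the case n = 2, x = alpha of the same computation:
   there the three terms are the associativity of mu and the averaging identities. *)

Require Import Defs.
From HB Require Import structures.
From mathcomp Require Import all_boot all_order all_algebra all_fingroup.
From mathcomp Require Import all_classical.
From mathcomp Require Import zify.
(* Imported again so that comp, hom, inj, total denote those of Defs. *)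
Require Import Defs.
Set Implicit Arguments.
Unset Strict Implicit.
Unset Printing Implicit Defensive.
Import Order.TTheory GRing.Theory Num.Theory.
Local Open Scope classical_set_scope.
Local Open Scope ring_scope.

(** * Permutation signs *)

Lemma signr_odd_eq (R : pzRingType) (m n : nat) :
  odd m = odd n -> (-1) ^+ m = (-1) ^+ n :> R.
Proof. by rewrite -(signr_odd _ m) -(signr_odd _ n) => ->. Qed.

(** The signs of the operations are powers of $-1$ with integer exponents built from degrees. This
    replaces each by a natural power, leaving a parity question on the absolute value. *)
Lemma signz_eq (k : fieldType) (z : int) (n : nat) :
  odd `|z| = odd n -> (-1 : k) ^ z = (-1) ^+ n.
Proof.
move=> e; case: (intP z) e => [|m|m] e.
- by rewrite expr0z -[LHS](expr0 (-1)); apply: signr_odd_eq.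
- exact: signr_odd_eq.
by rewrite -exprnN -exprVn invrN1; apply: signr_odd_eq; rewrite -e; congr odd; lia.
Qed.

(* The two Vandermonde determinants for the nodes i and s(i) differ by the sign of s. *)
Lemma inversion_sign n (s : 'S_n) :
  \prod_(i < n) \prod_(j < n | (i < j)%N) Num.sg ((s j)%:Z - (s i)%:Z) =
  (-1) ^+ (s : bool).
Proof.
pose V (t : 'S_n) := Vandermonde n (\row_i (t i)%:Z).
have detV t : \det (V t) = \prod_(i < n) \prod_(j < n | (i < j)%N) ((t j)%:Z - (t i)%:Z).
  by rewrite det_Vandermonde; do 2![apply: eq_bigr => ? _]; rewrite !mxE.
have sgV t : Num.sg (\det (V t)) =
    \prod_(i < n) \prod_(j < n | (i < j)%N) Num.sg ((t j)%:Z - (t i)%:Z).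
  rewrite detV (big_morph _ (@sgrM _) (sgr1 _)); apply: eq_bigr => i _.
  by rewrite (big_morph _ (@sgrM _) (sgr1 _)).
rewrite -sgV (_ : V s = col_perm s (V 1%g)); last first.
  by apply/matrixP => i j; rewrite !mxE !perm1.
rewrite col_permE det_mulmx det_perm odd_permV sgrM sgV.
(* For the identity permutation all factors $j - i$ with $i < j$ are positive, so only the
   determinant of the permutation matrix contributes a sign. *)
rewrite big1 ?mul1r => [|i _].
  by case: (odd_perm s); rewrite ?expr0 ?sgr1 // expr1 sgrN1.
by rewrite big1 // => j ij; rewrite gtr0_sg // !perm1 subr_gt0 ltz_nat.
Qed.

(** Exchanging two letters of degree $-1$ costs $-1$, so the Koszul sign counts inversions. By
    [inversion_sign] it is the signature again, and the two cancel in [chi]. *)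
Lemma chi_constN1 (k : fieldType) n (s : 'S_n) : chi k s (fun _ => -1) = 1.
Proof.
rewrite /chi; suff ->: koszul_sign k s (fun _ => -1) = (-1) ^+ (s : bool) by rewrite -signr_addb addbb.
(* [inversion_sign] is an identity between integers; it is transported to [k] along the canonical
   ring morphism. *)
have ->: (-1) ^+ (s : bool) = ((-1) ^+ (s : bool))%:~R :> k.
  by rewrite rmorph_sign.
rewrite -inversion_sign rmorph_prod; apply: eq_bigr => i _.
rewrite rmorph_prod big_mkcondr; apply: eq_bigr => j ij.
have nij : (s i : nat) != s j by rewrite val_eqE (inj_eq perm_inj) -val_eqE neq_ltn ij.
case: ltnP => sij.
  by rewrite ltr0_sg ?subr_lt0 ?ltz_nat // mulrNN mulr1 expr1z mulrN1z.
by rewrite gtr0_sg // subr_gt0 ltz_nat ltn_neqAle nij.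
Qed.

Lemma big_perm2 (V : nmodType) (F : 'S_2 -> V) :
  \sum_(s : 'S_2) F s = F 1%g + F (tperm ord0 ord_max).
Proof.
rewrite (bigD1 1%g) //= (bigD1 (tperm ord0 ord_max)) /=; last first.
  by apply/eqP => /permP /(_ ord0); rewrite tpermL perm1.
rewrite big1 ?addr0 // => s /andP[s1 st].
have I2 (i : 'I_2) : i = ord0 \/ i = ord_max.
  by case: i => [[|[|//]] ?]; [left|right]; apply: val_inj.
case: (I2 (s ord0)) => s0.
  case: (I2 (s ord_max)) => sm; first by move: (perm_inj (etrans s0 (esym sm))).
  by case/eqP: s1; apply/permP => i; rewrite perm1; case: (I2 i) => ->.
case: (I2 (s ord_max)) => sm; last by move: (perm_inj (etrans s0 (esym sm))).
by case/eqP: st; apply/permP => i; case: (I2 i) => ->; rewrite ?tpermL ?tpermR.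
Qed.

(** * Multilinear maps *)

(** The equality test on [summand] is inherited from ['I_5] through [inord], so it is resolved with
    this table of rewriting rules rather than by simplification. *)
Lemma summand_neq :
  (((SK == SA) = false) * ((SV == SA) = false) * ((Sr == SA) = false) *
   ((Sl == SA) = false) * ((SA == SK) = false) * ((SV == SK) = false) *
   ((Sr == SK) = false) * ((Sl == SK) = false) * ((SA == SV) = false) *
   ((SK == SV) = false) * ((Sr == SV) = false) * ((Sl == SV) = false) *
   ((SA == Sr) = false) * ((SK == Sr) = false) * ((SV == Sr) = false) *
   ((Sl == Sr) = false) * ((SA == Sl) = false) * ((SK == Sl) = false) *
   ((SV == Sl) = false) * ((Sr == Sl) = false))%type.
Proof. by do ![split]; apply/eqP. Qed.

Lemma degA (k : fieldType) (R : lmodType k) n (f : seq R -> R) :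
  deg (Mono SA n f) = 1 - n%:Z.
Proof. by rewrite /deg /degree eqxx. Qed.

Lemma degO (k : fieldType) (R : lmodType k) s n (f : seq R -> R) :
  s != SA -> deg (Mono s n f) = - n%:Z.
Proof. by rewrite /deg /degree /= => /negPf ->; rewrite sub0r. Qed.

Section HomClosure.
Variables (k : fieldType) (R : lmodType k).
Implicit Types (f g : seq R -> R) (w u v : seq R).

Lemma hom_size n f w : hom n f -> size w != n -> f w = 0.
Proof. by case=> + _; apply. Qed.

Lemma hom_linear n f : hom n f -> forall u v (a : k) x y, (size u + size v).+1 = n ->
  f (u ++ (a *: x + y) :: v) = a *: f (u ++ x :: v) + f (u ++ y :: v).
Proof. by case. Qed.

Lemma homI n f : (forall w, size w != n -> f w = 0) ->
  (forall u v (a : k) (x y : R), (size u + size v).+1 = n ->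
     f (u ++ (a *: x + y) :: v) = a *: f (u ++ x :: v) + f (u ++ y :: v)) ->
  hom n f.
Proof. by []. Qed.

Lemma homZD n (a : k) f g : hom n f -> hom n g -> hom n (a *: f + g).
Proof.
move=> hf hg; apply: homI => [w hw|u v b x y huv].
  by rewrite addrfctE scalrfctE (hom_size hf hw) (hom_size hg hw) scaler0 addr0.
rewrite !addrfctE !scalrfctE (hom_linear hf) // (hom_linear hg) // !scalerDr !scalerA.
by rewrite mulrC !addrA; congr (_ + _); rewrite -!addrA; congr (_ + _); exact: addrC.
Qed.

Lemma hom_cst0 n : hom n (0 : seq R -> R).
Proof. by apply: homI => // u v a x y _; rewrite scaler0 addr0. Qed.

Lemma homZ n (a : k) f : hom n f -> hom n (a *: f).
Proof. by move=> hf; rewrite -[_ *: _]addr0; apply: homZD => //; exact: hom_cst0. Qed.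

Lemma homD n f g : hom n f -> hom n g -> hom n (f + g).
Proof. by move=> hf hg; rewrite -[f]scale1r; exact: homZD. Qed.

Lemma homB n f g : hom n f -> hom n g -> hom n (f - g).
Proof. by move=> hf hg; rewrite addrC -scaleN1r; exact: homZD. Qed.

Lemma hom_sum n (I : Type) (r : seq I) (F : I -> seq R -> R) (P : pred I) :
  (forall i, P i -> hom n (F i)) -> hom n (\sum_(i <- r | P i) F i).
Proof.
by move=> hF; elim/big_ind: _ => //; [exact: hom_cst0 | exact: homD].
Qed.

Lemma hom_unary (A : {linear R -> R}) : hom 1 (unary A).
Proof.
apply: homI => [[|x [|y w]] //|u v a x y].
by case: u v => [|? u] [|? v] //= _; rewrite linearP.
Qed.

Lemma hom_binary (op : R -> R -> R) :
  (forall a x y z, op (a *: x + y) z = a *: op x z + op y z) ->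
  (forall a x y z, op z (a *: x + y) = a *: op z x + op z y) ->
  hom 2 (binary op).
Proof.
move=> opl opr; apply: homI => [[|x [|y [|z w]]] //|u v a x y].
by case: u v => [|? [|? u]] [|? [|? v]] //= _.
Qed.

(** The unsigned partial composition $f \circ_i g$ of operad theory. Braces and the terms of the
    differentials all reduce to it, so multilinearity is checked once for this operation. *)
Definition insertion n m i f g w : R :=
  if size w == (n + m).-1 then
    f (take i w ++ g (take m (drop i w)) :: drop (i + m) w)
  else 0.

(** The varied letter, at position [size u], lies before, inside or after the block of [m] letters
    fed to [g]. Linearity comes from [g] followed by [f] if it is inside, and from [f] alone
    otherwise. *)
Lemma hom_insertion n m i f g :
  (i < n)%N -> hom n f -> hom m g -> hom (n + m).-1 (insertion n m i f g).
Proof.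
move=> lin hf hg; apply: homI => [w /negPf sw|u v a x y suv]; first by rewrite /insertion sw.
have sz z : size (u ++ z :: v) == (n + m).-1 by rewrite size_cat /= addnS suv.
rewrite /insertion !sz !take_cat !drop_cat.
case: (ltnP i (size u)) => iu; last first.
  case: (posnP (i - size u)) => iu0.
    rewrite iu0 take0 drop0 cats0.
    (* The block starts at the varied letter. If [m] is 0 the block is empty: [g [::]] is a constant
       inserted just before that letter. Otherwise the letter is the first of the block. *)
    case: m hg suv sz => [|m] hg suv sz.
      rewrite addn0 (_ : (i < size u)%N = false) ?iu0 ?drop0; last by lia.
      rewrite !take0.
      rewrite -!(cat_rcons (g [::]) u) (hom_linear hf) ?size_rcons //. lia.
    have -> : (i + m.+1 < size u)%N = false by lia.
    have -> : (i + m.+1 - size u)%N = m.+1 by lia.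
    rewrite /= (hom_linear hg (u := [::])) /=; last by rewrite size_take; case: ltnP; lia.
    rewrite (hom_linear hf) //; rewrite size_drop; lia.
  have -> : (i + m < size u)%N = false by lia.
  have -> : (i + m - size u)%N = (i - size u + m)%N by lia.
  case: (i - size u)%N iu0 (subnKC iu) => // j _ ej; rewrite addSn /= -!catA !cat_cons.
  by rewrite (hom_linear hf) // size_cat /= size_take size_drop; case: ltnP; lia.
rewrite !take_cat size_drop.
case: (ltnP m (size u - i)) => mu.
  rewrite (_ : (i + m < size u)%N); last by lia.
  rewrite -!(cat_cons (g _)) !catA (hom_linear hf) // !size_cat /= size_drop size_takel; lia.
have -> : (i + m < size u)%N = false by lia.
have -> : (i + m - size u)%N = (m - (size u - i))%N by lia.
(* If the difference is 0, the varied letter comes immediately after the block; otherwise it is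
   inside. *)
case: (m - (size u - i))%N (subnKC mu) => [|j] ej.
  rewrite !take0 !drop0 !cats0.
  rewrite -!(cat_rcons (g _)) (hom_linear hf) // size_rcons size_takel //; lia.
rewrite /= (hom_linear hg); last by rewrite size_drop size_take; case: ltnP; lia.
rewrite (hom_linear hf) //; rewrite size_takel ?size_drop; lia.
Qed.

Lemma brace_insertion (f g : mono R) :
  brace f g = \sum_(i < ar f) (-1 : k) ^ (deg g * i%:Z) *: insertion (ar f) (ar g) i (ev f) (ev g).
Proof.
apply/funext => w; rewrite /brace fct_sumE; case: ifP => sw.
  by apply: eq_bigr => i _; rewrite /insertion scalrfctE sw.
by rewrite big1 // => i _; rewrite /insertion scalrfctE sw scaler0.
Qed.

Lemma hom_brace (f g : mono R) : hom (ar f) (ev f) -> hom (ar g) (ev g) ->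
  hom (ar f + ar g).-1 (brace f g).
Proof.
move=> hf hg; rewrite brace_insertion; apply: hom_sum => i _.
by apply: homZ; exact: hom_insertion.
Qed.

Lemma hom_comp_linear n (A : {linear R -> R}) f : hom n f -> hom n (fun w => A (f w)).
Proof.
move=> hf; apply: homI => [w /(hom_size hf)->|u v a x y uv]; first exact: linear0.
by rewrite (hom_linear hf) // linearP.
Qed.

Lemma hom_map n (A : {linear R -> R}) f : hom n f -> hom n (fun w => f (map A w)).
Proof.
move=> hf; apply: homI => [w sw|u v a x y uv]; first by rewrite (hom_size hf) ?size_map.
by rewrite !map_cat /= linearP (hom_linear hf) // !size_map.
Qed.

Lemma hom_map_tail n (A : {linear R -> R}) f : hom n f -> hom n (fun w => f (map_tail A w)).
Proof.
move=> hf; apply: homI => [[|x w] sw|[|z u] v a x y uv] /=.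
- exact: (hom_size hf).
- by rewrite (hom_size hf) //= size_map.
- by rewrite (hom_linear hf (u := [::])) //= size_map.
rewrite !map_cat /= linearP -!cat_cons (hom_linear hf) // -uv /= !size_map; lia.
Qed.

Lemma map_belast_rcons (A : R -> R) w x : map_belast A (rcons w x) = rcons (map A w) x.
Proof. by case: w => //= y w; rewrite belast_rcons last_rcons. Qed.

Lemma hom_map_belast n (A : {linear R -> R}) f :
  hom n f -> hom n (fun w => f (map_belast A w)).
Proof.
move=> hf; apply: homI => [w|u v a x y].
  case/lastP: w => [|w x] sw; first exact: (hom_size hf).
  by rewrite map_belast_rcons (hom_size hf) // size_rcons size_map -(size_rcons w x).
case/lastP: v => [|v z] uv.
  rewrite !cats1 !map_belast_rcons -!cats1 (hom_linear hf) // size_map //.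
rewrite -!rcons_cons -!rcons_cat !map_belast_rcons !map_cat /= linearP.
rewrite !rcons_cat !rcons_cons (hom_linear hf) // size_rcons !size_map.
by rewrite size_rcons in uv.
Qed.

End HomClosure.

(** * Differentials *)

Section Differentials.
Variables (k : fieldType) (R : lmodType k).
Variables (mu : {bilinear R -> R -> R}) (A : {linear R -> R}).
Implicit Types (f g : seq R -> R) (w : seq R) (op : R -> R -> R).

Local Notation mu_mono := (Mono SA 2 (binary mu)).

(** This lemma and the next two match partial compositions with the terms of a Hochschild-type
    differential: a product inserted into [f] gives an inner term, [f] in slot 0 of a product gives
    the last term, [f] in slot 1 the first. *)
Lemma insertion_binary n i f op w : size w = n.+1 -> (i < n)%N ->
  insertion n 2 i f (binary op) w = f (merge_at op i w).
Proof.
move=> sw lin; rewrite /insertion sw addn2 eqxx /merge_at addn2.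
rewrite (drop_nth 0) ?sw; last by lia.
by rewrite (drop_nth 0 (n := i.+1)) ?sw //= take0.
Qed.

Lemma binary_insertion0 n f op w : size w = n.+1 ->
  insertion 2 n 0 (binary op) f w = op (f (take n w)) (last 0 w).
Proof.
move=> sw; rewrite /insertion sw eqxx take0 drop0 /=.
case/lastP: w sw => [//|w x]; rewrite size_rcons => -[<-].
by rewrite last_rcons -cats1 drop_size_cat ?take_size_cat.
Qed.

Lemma binary_insertion1 n f op w : size w = n.+1 ->
  insertion 2 n 1 (binary op) f w = op (head 0 w) (f (behead w)).
Proof.
move=> sw; rewrite /insertion sw eqxx.
case: w sw => [//|x w] /= [<-].
by rewrite take0 drop0 take_size drop_size.
Qed.

Let muDl a x y z : mu (a *: x + y) z = a *: mu x z + mu y z.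
Proof. exact: linearPl. Qed.
Let muDr a x y z : mu z (a *: x + y) = a *: mu z x + mu z y.
Proof. exact: linearPr. Qed.

Let hom_mu : hom 2 (binary mu).
Proof. exact: hom_binary. Qed.

(** The slots 0 and 1 of [mu] give the last and the first term, with signs $1$ and $(-1)^{n+1}$
    because $|f| = 1-n$. The inner terms carry $(-1)^i$ for 0-based $i$; the minus of the bracket
    turns this into $(-1)^{i+1}$. *)
Lemma gerstenhaber_hochschild n f :
  gerstenhaber mu_mono (Mono SA n f) = (-1 : k) ^+ n.+1 *: hochschild mu n f.
Proof.
apply/funext => w; rewrite /gerstenhaber !brace_insertion !fct_sumE scalrfctE.
rewrite /hochschild; case: eqP => sw; last first.
  have {}sw : (size w == n.+1) = false by apply/eqP.
  rewrite scaler0 !big1 ?scaler0 ?subr0 // => i _ /=.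
    by rewrite /insertion scalrfctE addn2 sw scaler0.
  by rewrite /insertion scalrfctE add2n sw scaler0.
rewrite big_ord_recl big_ord1 /= !scalrfctE /bump /=.
rewrite binary_insertion0 // binary_insertion1 // mulr0 expr0z scale1r mulr1.
rewrite (_ : (-1) ^ deg (Mono SA n f) = (-1) ^+ n.+1 :> k); last first.
  by apply: signz_eq; rewrite !degA; lia.
rewrite (_ : (-1) ^ (deg mu_mono * deg (Mono SA n f)) = (-1) ^+ n.+1 :> k); last first.
  by apply: signz_eq; rewrite !degA; lia.
rewrite !scalerDr scalerA -expr2 sqrr_sign scale1r -addrA [LHS]addrC.
congr (_ + _ + _).
rewrite -scalerN; congr (_ *: _); rewrite -sumrN; apply: eq_bigr => i _.
rewrite scalrfctE insertion_binary // -scaleNr; congr (_ *: _).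
rewrite exprS mulN1r; congr (- _); apply: signz_eq.
by rewrite !degA; lia.
Qed.

(** Up to an invertible sign this is a Gerstenhaber bracket, and braces preserve multilinearity. *)
Lemma hom_hochschild n f : hom n f -> hom n.+1 (hochschild mu n f).
Proof.
move=> hf; have -> : hochschild mu n f =
    (-1 : k) ^+ n.+1 *: gerstenhaber mu_mono (Mono SA n f).
  by rewrite gerstenhaber_hochschild scalerA -expr2 sqrr_sign scale1r.
have -> : gerstenhaber mu_mono (Mono SA n f) =
    brace mu_mono (Mono SA n f) - (-1 : k) ^ (deg mu_mono * deg (Mono SA n f)) *:
      brace (Mono SA n f) mu_mono by [].
apply/homZ/homB; first exact: (@hom_brace _ _ mu_mono (Mono SA n f)).
apply: homZ; have := @hom_brace _ _ (Mono SA n f) mu_mono.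
by rewrite /= addn2; apply.
Qed.

(** Every term is a partial composition with [mu] or with one of the products $x A(y)$, $A(x) y$,
    possibly followed by [A]. The same decomposition serves for [partial_l]. *)
Lemma hom_partial_r n f : hom n f -> hom n.+1 (partial_r mu A n f).
Proof.
move=> hf; pose opr x y := mu x (A y); pose opl x y := mu (A x) y.
have hr : hom 2 (binary opr) by apply: hom_binary => *; rewrite /opr ?linearP ?muDl ?muDr.
have hl : hom 2 (binary opl) by apply: hom_binary => *; rewrite /opl ?linearP ?muDl ?muDr.
have -> : partial_r mu A n f =
    insertion 2 n 1 (binary opl) f - (fun w => A (insertion 2 n 1 (binary mu) f w))
    + \sum_(i < n) (-1 : k) ^+ i.+1 *: insertion n 2 i f (binary opr)
    + (-1 : k) ^+ n.+1 *: insertion 2 n 0 (binary opr) f.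
  apply/funext => w; rewrite !addrfctE opprfctE scalrfctE fct_sumE /partial_r.
  case: eqP => sw.
    rewrite !binary_insertion1 // binary_insertion0 //; congr (_ + _ + _).
    by apply: eq_bigr => i _; rewrite scalrfctE insertion_binary.
  have {}sw : (size w == n.+1) = false by apply/eqP.
  rewrite big1 => [|i _]; rewrite /insertion ?scalrfctE ?addn2 ?add2n sw ?scaler0 //.
  by rewrite linear0 subr0 !addr0.
have h1 (op : R -> R -> R) i : (i < 2)%N -> hom 2 (binary op) ->
    hom n.+1 (insertion 2 n i (binary op) f).
  by move=> i2 hop; exact: (@hom_insertion _ _ 2 n).
apply: homD; last exact/homZ/h1.
apply: homD; first by apply: homB; [exact: h1|exact/hom_comp_linear/h1].
apply: hom_sum => i _; apply: homZ.
by have := hom_insertion (ltn_ord i) hf hr; rewrite addn2.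
Qed.

Lemma hom_partial_l n f : hom n f -> hom n.+1 (partial_l mu A n f).
Proof.
move=> hf; pose opr x y := mu x (A y); pose opl x y := mu (A x) y.
have hr : hom 2 (binary opr) by apply: hom_binary => *; rewrite /opr ?linearP ?muDl ?muDr.
have hl : hom 2 (binary opl) by apply: hom_binary => *; rewrite /opl ?linearP ?muDl ?muDr.
have -> : partial_l mu A n f =
    insertion 2 n 1 (binary opl) f
    + \sum_(i < n) (-1 : k) ^+ i.+1 *: insertion n 2 i f (binary opl)
    + (-1 : k) ^+ n.+1 *: insertion 2 n 0 (binary opr) f
    + (-1 : k) ^+ n *: (fun w => A (insertion 2 n 0 (binary mu) f w)).
  apply/funext => w; rewrite !addrfctE !scalrfctE fct_sumE /partial_l.
  case: eqP => sw.
    rewrite !binary_insertion1 // !binary_insertion0 //; congr (_ + _ + _ + _).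
    by apply: eq_bigr => i _; rewrite scalrfctE insertion_binary.
  have {}sw : (size w == n.+1) = false by apply/eqP.
  rewrite big1 => [|i _]; rewrite /insertion ?scalrfctE ?addn2 ?add2n sw ?scaler0 //.
  by rewrite linear0 scaler0 !addr0.
have h1 (op : R -> R -> R) i : (i < 2)%N -> hom 2 (binary op) ->
    hom n.+1 (insertion 2 n i (binary op) f).
  by move=> i2 hop; exact: (@hom_insertion _ _ 2 n).
apply: homD; last exact/homZ/hom_comp_linear/h1.
apply: homD; last exact/homZ/h1.
apply: homD; first exact: h1.
apply: hom_sum => i _; apply: homZ.
by have := hom_insertion (ltn_ord i) hf hl; rewrite addn2.
Qed.

Lemma hom_partial0 f : hom 1 (partial0 mu A f).
Proof.
apply: homI => [[|x [|y w]] //|u v b x y].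
case: u v => [|? u] [|? v] //= _.
have AD := linearP A; rewrite !(muDl, muDr, AD).
rewrite !scalerDr !scalerN !opprD.
by do 3![rewrite [RHS]addrACA; congr (_ + _)].
Qed.

Lemma hom_Phi n f : hom n f -> C_AvO R n (Phi A n f).
Proof.
move=> hf; case: n hf => [//|[|n]] hf /=.
  by apply: (@homB _ _ 1); [exact: hom_map|exact: hom_comp_linear].
split; apply: (@homB _ _ n.+2); (try exact: hom_map); apply: hom_comp_linear.
  exact: hom_map_tail.
exact: hom_map_belast.
Qed.

Lemma C_AvO_partial n (g : AvO R n) : C_AvO R n g -> C_AvO R n.+1 (partial mu A g).
Proof.
case: n g => [|[|n]] g /=; first by move=> _; exact: hom_partial0.
  by move=> hg; split; [exact: hom_partial_r|exact: hom_partial_l].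
by case=> hr hl; split; [exact: hom_partial_r|exact: hom_partial_l].
Qed.

Lemma C_AvO_linear n (a : k) (g h : AvO R n) :
  C_AvO R n g -> C_AvO R n h -> C_AvO R n (a *: g + h).
Proof.
case: n g h => [|[|n]] g h /=; [exact: homZD|exact: homZD|].
by move=> [g1 g2] [h1 h2]; split; exact: homZD.
Qed.

Lemma C_AvA_d n (x : AvA R n) : C_AvA R n x -> C_AvA R n.+1 (d_AvA mu A n x).
Proof.
case: n x => [|n] x /=; first by move=> hx; split=> //; exact: hom_hochschild.
move=> [h1 h2]; split; first exact: hom_hochschild.
apply: (@C_AvO_linear n.+1); first exact: hom_Phi.
exact: C_AvO_partial.
Qed.

End Differentials.

(** * The identification *)

Lemma arity_SA n : arity SA (1 - n%:Z) = n.
Proof. by rewrite /arity eqxx; lia. Qed.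

Lemma arity_AvO s n : s != SA -> arity s (1 - n.+1%:Z) = n.
Proof. by rewrite /arity => /negPf ->; lia. Qed.

Lemma occurs_SA n : occurs SA (1 - n%:Z).
Proof. by rewrite /occurs arity_SA /degree eqxx /= eqxx. Qed.

(** In degree 1 the absolute value makes [arity] return 1, but maps of arity 1 with values in $R$
    have degree $-1$; the degree test in [occurs] rejects them. *)
Lemma occurs_AvO0 s : s != SA -> occurs s (1 - 0%:Z) = false.
Proof. by rewrite /occurs /arity /degree => /negPf ->; rewrite andbC. Qed.

Lemma occurs_AvOS s n : s != SA -> occurs s (1 - n.+1%:Z) = arity_ok s n.
Proof.
move=> sA; rewrite /occurs arity_AvO // /degree (negPf sA).
by rewrite (_ : _ == _) ?andbT //; lia.
Qed.

Lemma summand_neqA : (SK != SA) * (SV != SA) * (Sr != SA) * (Sl != SA).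
Proof. by rewrite !summand_neq. Qed.

Section Identification.
Variables (k : fieldType) (R : lmodType k).

Lemma totalD (X Y : total R) s : (X + Y) s = X s + Y s.
Proof. by []. Qed.

Lemma totalZ (a : k) (X : total R) s : (a *: X) s = a *: X s.
Proof. by []. Qed.

Lemma injE s s' (f : seq R -> R) : inj s f s' = if s' == s then f else 0.
Proof. by []. Qed.

Definition totalE :=
  (totalD, totalZ, injE, summand_neq, eqxx, scaler0, addr0, add0r).

Lemma id_sign_sqr n : id_sign k n * id_sign k n = 1.
Proof. by rewrite /id_sign -expr2 sqrr_sign. Qed.

Lemma injZD s (a : k) (f g : seq R -> R) : inj s (a *: f + g) = a *: inj s f + inj s g.
Proof. by apply/funext => s'; rewrite !totalE; case: eqP; rewrite ?scaler0 ?addr0. Qed.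

Lemma ident_linear n : linear (ident (R := R) n).
Proof.
have sZ (a b : k) (X Y : total R) : b *: (a *: X + Y) = a *: (b *: X) + b *: Y.
  by rewrite scalerDr !scalerA mulrC.
have ZDD (a : k) (X Y X' Y' : total R) :
    (a *: X + Y) + (a *: X' + Y') = a *: (X + X') + (Y + Y').
  by rewrite addrACA scalerDr.
case: n => [|[|[|n]]] a x y /=; rewrite !injZD ?ZDD !(sZ a) ?ZDD //.
Qed.

(** The signs are their own inverses. The second component of a cochain of degree $n$ has arity
    $n-1$, so its summand changes at $n = 1$, $2$ and $3$. *)
Definition ident_inv n : total R -> AvA R n :=
  match n with
  | 0 => fun X => id_sign k 0 *: X SA
  | 1 => fun X => (id_sign k 1 *: X SA, id_sign k 0 *: X SK)
  | 2 => fun X => (id_sign k 2 *: X SA, id_sign k 1 *: X SV)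
  | n'.+3 => fun X => (id_sign k n'.+3 *: X SA,
                       (id_sign k n'.+2 *: X Sr, id_sign k n'.+2 *: X Sl))
  end.

Lemma identK n : cancel (ident (R := R) n) (@ident_inv n).
Proof.
case: n => [|[|[|n]]] x /=.
- by rewrite !totalE scalerA id_sign_sqr scale1r.
- by case: x => f g; rewrite !totalE /= !scalerA !id_sign_sqr !scale1r.
- by case: x => f g; rewrite !totalE /= !scalerA !id_sign_sqr !scale1r.
by case: x => f [g h]; rewrite !totalE /= !scalerA !id_sign_sqr !scale1r.
Qed.

Lemma grade_SA n (X : total R) : grade R (1 - n%:Z) X -> hom n (X SA).
Proof. by move=> /(_ SA); rewrite occurs_SA arity_SA. Qed.

Lemma grade_AvO n (X : total R) s : grade R (1 - n.+1%:Z) X -> s != SA ->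
  if arity_ok s n then hom n (X s) else X s = 0.
Proof. by move=> /(_ s) + sA; rewrite occurs_AvOS // arity_AvO. Qed.

Lemma ident_invK n (X : total R) : grade R (1 - n%:Z) X -> ident n (ident_inv n X) = X.
Proof.
move=> hX; apply/funext => s; have [->|sA] := eqVneq s SA.
  by case: n hX => [|[|[|n]]] hX /=; rewrite !totalE scalerA id_sign_sqr scale1r.
case: n hX => [|n] hX.
  have := hX s; rewrite occurs_AvO0 // => ->.
  by rewrite /= !totalE (negPf sA) scaler0.
by have := grade_AvO hX sA; case: n hX sA => [|[|n]] hX; case: s => //= sA hs;
  rewrite !totalE ?hs // ?scalerA ?id_sign_sqr ?scale1r.
Qed.

Lemma ident_inv_C n (X : total R) : grade R (1 - n%:Z) X -> C_AvA R n (ident_inv n X).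
Proof.
case: n => [|n] hX; first exact: (homZ (id_sign k 0) (grade_SA hX)).
have h s : s != SA -> arity_ok s n -> hom n (X s).
  by move=> sA sn; have := grade_AvO hX sA; rewrite sn.
have hA := homZ (id_sign k n.+1) (grade_SA hX).
case: n h hA {hX} => [|[|n]] h hA; (split; first exact: hA); rewrite /=.
- by apply: (homZ (id_sign k 0)); apply: h; rewrite ?summand_neqA.
- by apply: (homZ (id_sign k 1)); apply: h; rewrite ?summand_neqA.
by split; apply: (homZ (id_sign k n.+2)); apply: h; rewrite ?summand_neqA.
Qed.

Lemma ident_grade n x : C_AvA R n x -> grade R (1 - n%:Z) (ident n x).
Proof.
move=> hx s; have [->|sA] := eqVneq s SA.
  rewrite occurs_SA arity_SA.
  by case: n x hx => [|[|[|n]]] x hx /=; rewrite !totalE; apply: homZ => //; case: hx.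
case: n x hx => [|n] x hx; first by rewrite occurs_AvO0 //= !totalE (negPf sA) scaler0.
rewrite occurs_AvOS // arity_AvO //.
case: n x hx => [|[|n]] [f g] [hf hg]; case: s sA => //=; rewrite ?eqxx // => _;
  rewrite !totalE //; apply: homZ => //; by case: hg.
Qed.

Lemma ident_bij n : set_bij (C_AvA R n) (grade R (1 - n%:Z)) (ident n).
Proof.
split=> [x|x y _ _ /(can_inj (@identK n))//|X hX]; first exact: ident_grade.
by exists (ident_inv n X); [exact: ident_inv_C|exact: ident_invK].
Qed.

(** The integers $d \le 1$ are the $1 - n$ treated by [ident_bij]; this covers the remaining
    degrees. *)
Lemma grade_gt1 (d : int) : 1 < d -> grade R d = [set 0].
Proof.
move=> d1; have nocc s : occurs s d = false.
  rewrite /occurs /degree /arity; case: (s == SA); apply/andP => -[_ /eqP]; lia.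
apply/seteqP; split=> X /=; first by move=> hX; apply/funext => s; have := hX s; rewrite nocc.
by move=> -> s; rewrite nocc.
Qed.

End Identification.

(** * Expansion of the operations at alpha *)

Lemma big_tuple_cons (T : finType) (V : nmodType) n (P : pred (seq T)) (F : seq T -> V) :
  \sum_(c : n.+1.-tuple T | P c) F c =
  \sum_(s : T) \sum_(c : n.-tuple T | P (s :: c)) F (s :: c).
Proof.
rewrite pair_big_dep /=.
rewrite (reindex (fun p : T * n.-tuple T => [tuple of p.1 :: p.2])) //=.
exists (fun c => (thead c, [tuple of behead c])) => [[s c] _|c _] /=.
  by rewrite theadE; congr (_, _); apply: val_inj.
by apply: val_inj; rewrite /= [in RHS](tuple_eta c).
Qed.

Lemma big_summand (V : nmodType) (H : summand -> V) :
  \sum_s H s = H SA + (H SK + (H SV + (H Sr + H Sl))).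
Proof.
rewrite (bigD1 SA) //= (bigD1 SK) ?summand_neq //= (bigD1 SV) ?summand_neq //=.
rewrite (bigD1 Sr) ?summand_neq //= (bigD1 Sl) ?summand_neq //= big1 ?addr0 //.
by case; rewrite ?eqxx ?andbF.
Qed.

Section Expansion.
Variables (k : fieldType) (R : lmodType k).

(** The multilinear sum over tuples of summands, unrolled one argument at a time. The components
    already chosen are stored in the continuation [G], so each copy of alpha can be split
    separately. *)
Fixpoint expand (G : seq (mono R) -> total R) (xs : seq (int * total R)) : total R :=
  if xs is dx :: xs' then
    \sum_(s | occurs s dx.1) expand (fun t => G (component s dx :: t)) xs'
  else G [::].

Lemma l_AvA_expand (xs : seq (int * total R)) : l_AvA R xs = expand (@l_mono k R) xs.
Proof.
rewrite /l_AvA; move: (@l_mono k R) => G; elim: xs G => [|dx xs IH] G /=.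
  by rewrite (big_pred1 [tuple]) // => c; rewrite [c]tuple0 [RHS]eqxx.
rewrite (big_tuple_cons _ (fun c => all2 (fun s dx => occurs s dx.1) c (dx :: xs))
  (fun c => G [seq component sx.1 sx.2 | sx <- zip c (dx :: xs)])) [RHS]big_mkcond.
apply: eq_bigr => s _ /=; case: ifP => _; last by rewrite big_pred0.
by rewrite -IH.
Qed.

Lemma expand_eq (G G' : seq (mono R) -> total R) xs :
  (forall t, size t = size xs -> G t = G' t) -> expand G xs = expand G' xs.
Proof.
elim: xs G G' => [|dx xs IH] G G' e /=; first exact: e.
by apply: eq_bigr => s _; apply: IH => t st; apply: e; rewrite /= st.
Qed.

Lemma expand0 (G : seq (mono R) -> total R) xs :
  (forall t, size t = size xs -> G t = 0) -> expand G xs = 0.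
Proof.
move=> e; rewrite (@expand_eq G (fun _ => 0)) //.
elim: xs {e} => [|dx xs IH] //=; exact: big1.
Qed.

Lemma expand_last n X (G : seq (mono R) -> total R) :
  expand G [:: (1 - n%:Z, X)] = G [:: Mono SA n (X SA)]
    + \sum_(s | occurs s (1 - n%:Z) && (s != SA)) G [:: Mono s n.-1 (X s)].
Proof.
rewrite /= (bigD1 SA) ?occurs_SA //= /component arity_SA; congr (_ + _).
(* For [n] equal to 0 no summand other than [SA] occurs, so the value of [n.-1] there is never
   reached. *)
apply: eq_bigr => s /andP[os sA]; case: n os => [|n] os; first by rewrite occurs_AvO0 in os.
by rewrite arity_AvO.
Qed.

Lemma in_A_SA n (f : seq R -> R) : in_A (Mono SA n f).
Proof. exact: eqxx. Qed.

Lemma l_mixed_sh (ys zs : seq (mono R)) sh : ~~ has (@in_A k R) ys -> in_A sh ->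
  l_mixed (ys ++ sh :: zs) =
  if ~~ has (@in_A k R) zs && (ar sh == size ys + size zs)%N then
    ((-1 : k) ^ (deg sh * (\sum_(g <- ys) deg g) + (size ys)%:Z)) *: l_sh sh (ys ++ zs)
  else 0.
Proof.
move=> hys hsh; rewrite /l_mixed find_cat (negPf hys) /= hsh addn0.
rewrite nth_cat ltnn subnn /= take_size_cat // -cat_rcons drop_size_cat ?size_rcons //.
rewrite count_cat -cats1 count_cat /= hsh !addn0 !size_cat.
have -> : count (@in_A k R) ys = 0%N by apply/eqP; rewrite -leqn0 -ltnS ltnNge -has_count.
by rewrite add0n -[1%N]addn1 eqn_add2l -leqn0 leqNgt -has_count.
Qed.

Lemma l_mixed_noA (ys : seq (mono R)) : ~~ has (@in_A k R) ys -> l_mixed ys = 0.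
Proof. by rewrite /l_mixed has_count; case: (count _ ys). Qed.

Variables (mu : R -> R -> R) (A : R -> R).
Local Notation mu_mono := (Mono SA 2 (binary mu)).
Local Notation tau := (Mono SV 1 (unary A)).
Local Notation alpha := (alpha_AvA mu A).

(** Degree $-1$ means arity 2 in [SA] and arity 1 elsewhere, which only [SV] admits; these
    components of alpha are [mu] and [tau]. *)
Lemma expand_alpha (G : seq (mono R) -> total R) xs :
  expand G ((-1, alpha) :: xs) =
  expand (fun t => G (mu_mono :: t)) xs + expand (fun t => G (tau :: t)) xs.
Proof.
have comp_alpha s : s = SA \/ s = SV -> component s (-1, alpha) =
    if s == SA then mu_mono else tau.
  have -> : (-1 : int) = 1 - 2%:Z by [].
  case=> ->; rewrite ?eqxx ?summand_neq /component ?arity_SA ?arity_AvO ?summand_neqA //=.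
    by rewrite /alpha_AvA !totalE.
  by rewrite /alpha_AvA !totalE.
have o s : occurs s (-1) = (s == SA) || (s == SV).
  have -> : (-1 : int) = 1 - 2%:Z by [].
  have [->|sA] := eqVneq s SA; first by rewrite occurs_SA.
  by rewrite occurs_AvOS //; case: s sA; rewrite ?eqxx ?summand_neq.
rewrite /= big_mkcond big_summand !o !summand_neq !eqxx /= !add0r addr0.
by rewrite !comp_alpha ?eqxx ?summand_neq; [ | right | left].
Qed.

Lemma has_nseq_tau n : has (@in_A k R) (nseq n tau) = false.
Proof. by rewrite has_nseq /= /in_A /= summand_neq andbF. Qed.

Variables (n : nat) (X : total R).
Local Notation XA := (Mono SA n (X SA)).
Local Notation word i := (nseq i (-1, alpha) ++ [:: (1 - n%:Z, X)]).

(* Choosing mu in some copy of alpha gives 0 unless there are exactly two other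
   arguments, since mu has arity 2. *)
Lemma expand_l_mixed i j : (i + j)%N != 2 ->
  expand (fun t => l_mixed (nseq j tau ++ t)) (word i) =
  expand (fun t => l_mixed (nseq (i + j) tau ++ t)) [:: (1 - n%:Z, X)].
Proof.
elim: i j => [//|i IH] j hij; rewrite [word _]/= expand_alpha.
rewrite expand0 ?add0r => [|t st].
  (* In the remaining branch the first copy of alpha is [tau], which joins the prefix and raises [j]
     by one. *)
  rewrite -[(fun t => _)]/(fun t => l_mixed (nseq j tau ++ tau :: t)).
  rewrite addSnnS -(IH j.+1) -?addSnnS //; apply: expand_eq => t _.
  by rewrite -[j.+1]addn1 nseqD -catA.
rewrite l_mixed_sh ?has_nseq_tau /in_A //= size_nseq st size_cat size_nseq /=.
by rewrite ifF //; apply/negP => /andP[_ /eqP]; lia.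
Qed.

Lemma l_AvA_alpha0 : l_AvA R (word 0) = if n == 0%N then inj SK (X SA) else 0.
Proof.
rewrite l_AvA_expand expand_last /= /in_A /= eqxx big1 => [|s /andP[_ /negPf ->] //].
by rewrite addr0.
Qed.

(** With [mu], only the [SA] part of [X] fits, since [mu] would need two arguments outside [SA].
    With [tau], the [SA] part must have arity 1. *)
Lemma l_AvA_alpha1 : l_AvA R (word 1) =
  inj SA (gerstenhaber mu_mono XA) + if n == 1%N then l_mixed [:: tau; XA] else 0.
Proof.
rewrite l_AvA_expand [word 1]/= expand_alpha !expand_last /= /in_A /= eqxx summand_neq /=.
rewrite !big1 ?addr0 => [|s /andP[_ /negPf sA]|s /andP[_ /negPf sA]] /=.
- congr (_ + _); case: eqP => // n1.
  by rewrite -[[:: _; _]]/([:: tau] ++ XA :: [::]) l_mixed_sh /in_A /= ?summand_neq //;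
    rewrite ifF //; apply/eqP.
- by rewrite l_mixed_noA //= /in_A /= summand_neq sA.
rewrite sA -[[:: _; _]]/([::] ++ mu_mono :: [:: Mono s n.-1 (X s)]) l_mixed_sh ?in_A_SA //.
by rewrite ifF //=; apply/negP => /andP[_].
Qed.

(** Exactly one of the three arguments may lie in [SA]. Either it is the [SA] part of [X], of arity
    2, behind two copies of [tau], or it is [mu] in one of two positions, next to [tau] and a
    component of [X] outside [SA]. *)
Lemma l_AvA_alpha2 : l_AvA R (word 2) =
  (if n == 2%N then l_mixed [:: tau; tau; XA] else 0)
  + \sum_(s | occurs s (1 - n%:Z) && (s != SA))
      (l_mixed [:: mu_mono; tau; Mono s n.-1 (X s)]
       + l_mixed [:: tau; mu_mono; Mono s n.-1 (X s)]).
Proof.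
rewrite l_AvA_expand [word 2]/= !expand_alpha !expand_last /=.
have hm (x y : mono R) : has (@in_A k R) [:: x; y] -> l_mixed [:: mu_mono; x; y] = 0.
  by move=> h; rewrite -[[:: _; _; _]]/([::] ++ mu_mono :: [:: x; y]) l_mixed_sh ?in_A_SA // h.
rewrite !hm /= /in_A /= ?eqxx ?orbT // !add0r big1 ?add0r => [|s _]; last first.
  by rewrite hm //= /in_A /= eqxx.
have -> : l_mixed [:: tau; mu_mono; XA] = 0.
  rewrite -[[:: _; _; _]]/([:: tau] ++ mu_mono :: [:: XA]) l_mixed_sh ?in_A_SA //=.
    by rewrite in_A_SA.
  by rewrite /in_A /= summand_neq.
rewrite add0r.
rewrite [X in _ + (_ + (_ + X))]big1 ?addr0 => [|s /andP[_ /negPf sA]]; last first.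
  by rewrite l_mixed_noA //= /in_A /= summand_neq sA.
rewrite big_split /= addrA [RHS]addrC; congr (_ + _); case: eqP => // n2.
rewrite -[[:: _; _; _]]/([:: tau; tau] ++ XA :: [::]) l_mixed_sh /in_A /= ?summand_neq //.
by rewrite ifF //; apply/eqP.
Qed.

(** With more than three arguments the binary [mu] cannot be used, so every copy of alpha is [tau]
    and the [SA] part of [X] must have arity [i]. *)
Lemma l_AvA_alpha3 i : (2 < i)%N -> l_AvA R (word i) =
  if i == n then l_mixed (rcons (nseq n tau) XA) else 0.
Proof.
move=> i2; rewrite l_AvA_expand.
rewrite (@expand_eq _ (fun t => l_mixed (nseq 0 tau ++ t))) => [|t]; last first.
  rewrite size_cat size_nseq /=; case: i i2 => [|[|[|i]]] // _.
  by case: t => [|x [|y [|z t]]] //=; rewrite ?addn1.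
rewrite expand_l_mixed ?addn0; last by rewrite gtn_eqF.
rewrite expand_last big1 ?addr0 => [|s /andP[_ /negPf sA]].
  case: eqP => [->|ni]; first by rewrite cats1.
  rewrite l_mixed_sh ?has_nseq_tau /in_A //= addn0 size_nseq ifF //.
  by apply/eqP => /esym.
by rewrite l_mixed_noA // has_cat has_nseq_tau /= /in_A /= sA.
Qed.

End Expansion.

(** * Brackets with tau *)

Section Brackets.
Variables (k : fieldType) (R : lmodType k).
Variables (mu : {bilinear R -> R -> R}) (A : {linear R -> R}).
Implicit Types (f g G : seq R -> R) (w : seq R) (h c : mono R).

Local Notation mu_mono := (Mono SA 2 (binary mu)).
Local Notation tau := (Mono SV 1 (unary A)).

Lemma deg_tau : deg tau = -1.
Proof. by rewrite degO ?summand_neqA. Qed.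

Lemma deg_mu : deg mu_mono = -1.
Proof. by rewrite degA. Qed.

(** Maps from $sR$ to $sR$ have degree 0 and therefore produce no Koszul sign. *)
Lemma comp_arity1 f n (hs : seq (seq R -> R)) w : size w = size hs ->
  ev (comp (Mono SA n f) (map (Mono SA 1) hs)) w =
  f [seq p.1 [:: p.2] | p <- zip hs w].
Proof.
have e : [seq ar i | i <- map (Mono SA 1) hs] = nseq (size hs) 1%N.
  by elim: hs => //= h hs ->.
have s : sumn (nseq (size hs) 1%N) = size hs by rewrite sumn_nseq mul1n.
move=> sw; rewrite /= e s sw eqxx /tensor_sign big1 => [|i _]; last first.
  rewrite big1 // => j _; rewrite (nth_map (fun=> 0)); last by rewrite -(size_map (Mono SA 1)).
  by rewrite degA subrr mul0r.
rewrite expr0z scale1r; congr f; elim: hs w sw {e s} => [|h hs IH] [|x w] //= [sw].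
by rewrite take0 drop0 IH.
Qed.

Lemma comp_size h (gs : seq (mono R)) w : size w != ar (comp h gs) -> ev (comp h gs) w = 0.
Proof. by rewrite /= => /negPf ->. Qed.

Lemma brace_tau c w : (size w != ar c -> ev c w = 0) -> brace tau c w = A (ev c w).
Proof.
rewrite /brace add1n /= => c0; case: eqP => [sw|/eqP /c0 ->]; last by rewrite linear0.
by rewrite big_ord1 mulr0 expr0z scale1r take0 drop0 -sw take_size drop_size.
Qed.

Lemma map_susp_tau n : map (@susp k R) (nseq n tau) = map (Mono SA 1) (nseq n (unary A)).
Proof. by rewrite !map_nseq. Qed.

Lemma zip_nseq_unary n w : size w = n ->
  [seq p.1 [:: p.2] | p <- zip (nseq n (unary A)) w] = map A w.
Proof. by move=> <-; elim: w => //= x w ->. Qed.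

Lemma nth_nseq_tau n (i : 'I_(size (nseq n tau))) : nth (mono0 R) (nseq n tau) i = tau.
Proof. by rewrite nth_nseq ifT //; move: (ltn_ord i); rewrite [X in (_ < X)%N]size_nseq. Qed.

Lemma permute_nseq n (s : 'S_(size (nseq n tau))) : permute s = nseq n tau.
Proof.
have cst (T : Type) (r : seq T) : [seq tau | _ <- r] = nseq (size r) tau.
  by elim: r => //= x r ->.
rewrite /permute (eq_map (g := fun=> tau)) ?cst ?size_enum_ord ?size_nseq // => i.
exact: nth_nseq_tau.
Qed.

(** The product $n(1-n)$ is even, and the double sum adds $-m$ for each $m < n$, that is
    $-\binom{n}{2}$. *)
Lemma bracket_sign n f (gs := nseq n tau) :
  (-1 : k) ^ (n%:Z * deg (Mono SA n f) + \sum_(1 <= m < n) \sum_(j < m) deg (nth (mono0 R) gs j)) =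
  (-1) ^+ 'C(n, 2).
Proof.
rewrite (_ : \sum_(1 <= m < n) _ = - ('C(n, 2))%:Z); last first.
  transitivity (\sum_(0 <= m < n) - (m%:Z) : int).
    case: n @gs => [|n] gs; first by rewrite !big_geq.
    rewrite [RHS]big_ltn // oppr0 add0r; apply: eq_big_nat => m /andP[_ mn].
    rewrite (eq_bigr (fun=> -1)) => [|j _]; last first.
      by rewrite nth_nseq (ltn_trans (ltn_ord j) mn) deg_tau.
    by rewrite sumr_const card_ord mulNrn natz.
  by rewrite sumrN -bin2_sum; congr (- _); rewrite -natz natr_sum; apply: eq_bigr => i _; rewrite natz.
apply: signz_eq; rewrite degA.
have : odd (absz (n%:Z * (1 - n%:Z))) = false.
  by rewrite abszM oddM; apply/negP => /andP[]; lia.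
move: (_ * _) ('C(_, _)) => a b; lia.
Qed.

(** Permuting equal letters changes neither the list nor, by [chi_constN1], the sign, so all $n!$
    terms agree. Since $|\tau| + 1 = 0$, the exponent [eta] vanishes. The position [p] stays general
    to serve both brackets. *)
Lemma bracket_tau pos n f p (w : seq R) : pos (nseq n tau) = p -> (p < n)%N -> hom n f ->
  bracket pos (Mono SA n f) (nseq n tau) w =
  ((n`!)%:R * (-1) ^+ 'C(n, 2)) *:
    (f (map A w) - A (ev (comp (Mono SA n f) (map (Mono SA 1)
       (nseq p (unary A) ++ head 0 :: nseq (n - p.+1) (unary A)))) w)).
Proof.
move=> hp pn hf; rewrite /bracket.
rewrite (eq_bigr (fun=> (-1) ^+ 'C(n, 2) *: (f (map A w) - A (ev (comp (Mono SA n f) (map (Mono SA 1)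
       (nseq p (unary A) ++ head 0 :: nseq (n - p.+1) (unary A)))) w)))) => [|s _].
  rewrite sumr_const [X in _ *+ X](_ : _ = n`!).
    by rewrite -scaler_nat scalerA.
  by rewrite -[LHS]/#|{perm 'I_(size (nseq n tau))}| card_Sn size_nseq.
rewrite permute_nseq hp nth_nseq pn deg_tau addNr mul0r expr0z scale1r.
have -> : chi k s (fun i => deg (nth (mono0 R) (nseq n tau) i)) = 1.
  rewrite -[RHS](chi_constN1 k s); congr chi.
  by apply/funext => i; rewrite nth_nseq_tau deg_tau.
rewrite mul1r size_nseq bracket_sign.
congr (_ *: (_ - _)).
  rewrite map_susp_tau; have [sw|sw] := eqVneq (size w) n.
    by rewrite comp_arity1 ?size_nseq // zip_nseq_unary.
  rewrite comp_size ?(hom_size hf) ?size_map //= -map_comp.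
  by rewrite (eq_map (g := fun=> 1%N)) // map_nseq sumn_nseq mul1n.
rewrite take_nseq ?drop_nseq; last exact: ltnW.
rewrite !map_susp_tau -[id_sV _]/(Mono SA 1 (head 0)) -map_cons -map_cat.
by rewrite brace_tau // => /comp_size.
Qed.

(** The identity sits in slot 0 and spares the first letter, whence [map_tail]; for [pos_l] it sits
    in the last slot, whence [map_belast]. *)
Lemma bracket_tau_r n f : hom n.+1 f ->
  bracket (@pos_r k R) (Mono SA n.+1 f) (nseq n.+1 tau) =
  ((n.+1`!)%:R * (-1) ^+ 'C(n.+1, 2)) *: Phi_r A f.
Proof.
move=> hf; apply/funext => w; rewrite (@bracket_tau _ _ _ 0) //; last first.
  by rewrite /pos_r /= /not_K /= summand_neq.
rewrite scalrfctE /Phi_r subn1; congr (_ *: (_ - A _)).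
have [sw|sw] := eqVneq (size w) n.+1.
  rewrite comp_arity1 /= ?size_nseq //; case: w sw => //= x w [sw].
  by rewrite zip_nseq_unary.
rewrite comp_size; last first.
  rewrite /= -map_comp (eq_map (g := fun=> 1%N)) // map_nseq sumn_nseq mul1n.
  by rewrite add1n.
by rewrite (hom_size hf) //; case: w sw => //= x w; rewrite size_map.
Qed.

Lemma bracket_tau_l n f : hom n.+1 f ->
  bracket (@pos_l k R) (Mono SA n.+1 f) (nseq n.+1 tau) =
  ((n.+1`!)%:R * (-1) ^+ 'C(n.+1, 2)) *: Phi_l A f.
Proof.
move=> hf; apply/funext => w; rewrite (@bracket_tau _ _ _ n) //; last first.
  have rv : rev (nseq n.+1 tau) = nseq n.+1 tau.
    by apply: (@eq_from_nth _ tau) => [|i]; rewrite size_rev // size_nseq => hi;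
      rewrite nth_rev ?size_nseq // !nth_nseq; do 2!case: ifP.
  by rewrite /pos_l rv /= /not_K /= summand_neq /= size_nseq ?subn0.
rewrite scalrfctE /Phi_l subnn; congr (_ *: (_ - A _)).
have [sw|sw] := eqVneq (size w) n.+1.
  rewrite comp_arity1 ?size_cat ?size_nseq ?addn1 //.
  case/lastP: w sw => // w x; rewrite size_rcons => -[sw].
  rewrite map_belast_rcons -[rcons w x]cats1 zip_cat ?size_nseq // map_cat zip_nseq_unary //.
  by rewrite cats1.
rewrite comp_size; last first.
  rewrite /= -map_comp (eq_map (g := fun=> 1%N)) // map_cat /= map_nseq sumn_cat sumn_nseq mul1n.
  by rewrite addn1.
rewrite (hom_size hf) //; case/lastP: w sw => // w x.
by rewrite map_belast_rcons !size_rcons size_map.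
Qed.

End Brackets.

(** * Brackets with mu and tau *)

Section ProductBrackets.
Variables (k : fieldType) (R : lmodType k).
Variables (mu : {bilinear R -> R -> R}) (A : {linear R -> R}).
Implicit Types (f g G : seq R -> R) (w : seq R) (h c : mono R) (op : R -> R -> R).

Local Notation mu_mono := (Mono SA 2 (binary mu)).
Local Notation tau := (Mono SV 1 (unary A)).

(** The term of [bracket] for an already permuted list, stripped of [chi] and [eps], so that the two
    orders of [tau] and $g$ can be compared. *)
Definition bracket_summand (pos : seq (mono R) -> nat) sh (gp : seq (mono R)) w : R :=
  let p := pos gp in
  let g := nth (mono0 R) gp p in
  ev (comp sh (map (@susp k R) gp)) w -
  ((-1 : k) ^ ((deg g + 1) * (deg sh + \sum_(j < p) (deg (nth (mono0 R) gp j) + 1)))) *: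
    brace g (comp sh (map (@susp k R) (take p gp) ++
                      id_sV R :: map (@susp k R) (drop p.+1 gp))) w.

Lemma permute2 (x y : mono R) (s : 'S_2) :
  permute (gs := [:: x; y]) s =
  [:: nth (mono0 R) [:: x; y] (s ord0); nth (mono0 R) [:: x; y] (s ord_max)].
Proof.
rewrite /permute /= !enum_ordSl /=.
rewrite (_ : enum 'I_0 = [::]) /=; last by apply: size0nil; rewrite size_enum_ord.
by congr [:: _; nth _ _ (val (s _))]; apply: val_inj.
Qed.

Lemma chi_transposition (d : 'I_2 -> int) :
  chi k (tperm ord0 ord_max) d = - (-1) ^ (d ord_max * d ord0).
Proof.
rewrite /chi /koszul_sign odd_tperm /= expr1 mulN1r; congr (- _).
rewrite !big_ord_recl big_ord0 mulr1 big_mkcond [X in _ * X]big_mkcond /=.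
rewrite !big_ord_recl !big_ord0 /= !mulr1.
rewrite (_ : lift ord0 ord0 = ord_max); last exact: val_inj.
by rewrite !tpermL !tpermR /= !mul1r ?mulr1.
Qed.

Lemma chi1 n (d : 'I_n -> int) : chi k 1 d = 1.
Proof.
rewrite /chi odd_perm1 expr0 mul1r /koszul_sign big1 // => i _; rewrite big1 // => j.
by rewrite !perm1 => /andP[]; case: ltngtP.
Qed.

(* The Koszul sign of the transposition compensates the change of eps. *)
Lemma bracket_mu pos s a G w : s != SA ->
  bracket pos mu_mono [:: tau; Mono s a G] w =
  - (bracket_summand pos mu_mono [:: tau; Mono s a G] w
     + bracket_summand pos mu_mono [:: Mono s a G; tau] w).
Proof.
move=> sA; rewrite /bracket [LHS]big_perm2 !permute2 !perm1 tpermL tpermR /=.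
rewrite chi1 chi_transposition /= !big_nat1 !big_ord1 /=.
rewrite -/(bracket_summand pos mu_mono [:: tau; Mono s a G] w).
rewrite -/(bracket_summand pos mu_mono [:: Mono s a G; tau] w).
rewrite deg_tau deg_mu degO // !mul1r opprD -!scaleN1r; congr (_ *: _ + _ *: _).
  exact: (signz_eq k (n := 1)).
rewrite (_ : (-1) ^ (- a%:Z * -1) = (-1) ^+ a :> k); last by apply: signz_eq; lia.
rewrite (_ : (-1) ^ (2%:Z * -1 - a%:Z) = (-1) ^+ a :> k); last by apply: signz_eq; lia.
by rewrite mulNr -expr2 sqrr_sign.
Qed.

Lemma comp2 h (g1 g2 : mono R) :
  comp h [:: g1; g2] = Mono (sec h) (ar g1 + ar g2) (fun w =>
    if size w == (ar g1 + ar g2)%N then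
      ((-1 : k) ^ (deg g2 * (ar g1)%:Z)) *:
        ev h [:: ev g1 (take (ar g1) w); ev g2 (take (ar g2) (drop (ar g1) w))]
    else 0).
Proof.
rewrite /comp /= addn0; congr Mono; apply/funext => w.
by rewrite /tensor_sign /= big_ord_recl big_ord1 big_ord0 add0r /= big_ord1.
Qed.

(** The sign comes from moving $sG$, of degree $1-a$, past the first letter. In the opposite order
    the unary map has degree 0 and there is none. Here [u] stands for [tau] or the identity. *)
Lemma comp_unary_mu (u : seq R -> R) a G :
  comp mu_mono [:: Mono SA 1 u; Mono SA a G] =
  Mono SA a.+1 ((-1 : k) ^+ a.+1 *:
    insertion 2 a 1 (binary (fun x y => mu (u [:: x]) y)) G).
Proof.
rewrite comp2 /= add1n; congr Mono; apply/funext => w; rewrite scalrfctE.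
case: eqP => sw; last by rewrite /insertion; move/eqP/negPf: sw => ->; rewrite scaler0.
rewrite binary_insertion1 // degA mulr1.
rewrite (_ : (-1) ^ _ = (-1) ^+ a.+1 :> k); last by apply: signz_eq; lia.
by case: w sw => //= x w [<-]; rewrite take0 drop0 take_size.
Qed.

Lemma comp_mu_unary (u : seq R -> R) a G :
  comp mu_mono [:: Mono SA a G; Mono SA 1 u] =
  Mono SA a.+1 (insertion 2 a 0 (binary (fun x y => mu x (u [:: y]))) G).
Proof.
rewrite comp2 /= addn1; congr Mono; apply/funext => w.
case: eqP => sw; last by rewrite /insertion; move/eqP/negPf: sw => ->.
rewrite binary_insertion0 // degA subrr mul0r expr0z scale1r.
case/lastP: w sw => //= w x; rewrite size_rcons => -[<-].
by rewrite -cats1 take_size_cat // drop_size_cat // last_cat.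
Qed.

Lemma comp_mu_unary2 (u v : seq R -> R) :
  comp mu_mono [:: Mono SA 1 u; Mono SA 1 v] =
  Mono SA 2 (binary (fun x y => mu (u [:: x]) (v [:: y]))).
Proof.
rewrite comp2 degA subrr; congr Mono; apply/funext => -[|x [|y [|z w]]] //=.
by rewrite expr0z scale1r.
Qed.

Lemma brace_merge s a G op w : size w = a.+1 ->
  brace (Mono s a G) (Mono SA 2 (binary op)) w =
  \sum_(i < a) (-1 : k) ^+ i *: G (merge_at op i w).
Proof.
move=> sw; rewrite brace_insertion fct_sumE; apply: eq_bigr => i _.
rewrite scalrfctE insertion_binary // degA; congr (_ *: _); apply: signz_eq.
by move: (nat_of_ord i) => j; lia.
Qed.

Lemma brace_size (g c : mono R) w : size w != (ar g + ar c).-1 -> brace g c w = 0.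
Proof. by rewrite /brace => /negPf ->. Qed.

Let sum_merge_neg n (op : R -> R -> R) G w :
  - (\sum_(i < n) (-1 : k) ^+ i *: G (merge_at op i w)) =
  \sum_(i < n) (-1 : k) ^+ i.+1 *: G (merge_at op i w).
Proof. by rewrite -sumrN; apply: eq_bigr => i _; rewrite exprS mulN1r scaleNr. Qed.

Let sign_eta a : (-1) ^ ((- a%:Z + 1) * -1) = (-1) ^+ a.+1 :> k.
Proof. by apply: signz_eq; lia. Qed.

(** In both orders $p$ selects the first entry. The order $(\tau, g)$ gives the terms
    $A(x_1)g(\ldots)$ and $A(x_1 g(\ldots))$; the order $(g, \tau)$ gives the last term and the
    insertions of $x A(y)$ into $g$. *)
Lemma bracket_mu_r s a G : s != SA -> s != SK ->
  bracket (@pos_r k R) mu_mono [:: tau; Mono s a G] =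
  - ((-1) ^+ a.+1 *: partial_r mu A a G).
Proof.
move=> sA sK; apply/funext => w; rewrite bracket_mu // opprfctE; congr (- _).
(* The composition with [mu] is hidden behind a variable, to keep simplification from unfolding it
   before the composition lemmas apply. *)
have [C eC] : exists C, C = Defs.comp mu_mono by eexists.
rewrite /bracket_summand -eC /pos_r /= /not_K /= summand_neq sK /= !big_ord0 !addr0.
rewrite deg_tau deg_mu degO // addNr mul0r expr0z scale1r sign_eta.
rewrite /susp /= /id_sV eC comp_mu_unary2 !comp_unary_mu comp_mu_unary /=.
have ins_size n (b f g : seq R -> R) j : size w != n.+1 -> insertion 2 n j b f w = 0.
  by rewrite /insertion add2n => /negPf ->.
rewrite brace_tau /= => [|sw]; last by rewrite scalrfctE ins_size // scaler0.
rewrite !scalrfctE; have [sw|sw] := eqVneq (size w) a.+1; last first.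
  rewrite !ins_size // brace_size ?addn2 // /partial_r (negPf sw).
  by rewrite !scaler0 (linear0 A) !subr0 addr0.
rewrite brace_merge // !binary_insertion1 // binary_insertion0 // /partial_r sw eqxx.
rewrite linearZ /= -scalerBr addrA.
rewrite [X in _ = X]scalerDr scalerA -expr2 sqrr_sign scale1r.
rewrite [X in _ = X + _]scalerDr -!addrA; congr (_ + _); rewrite addrC; congr (_ + _).
by rewrite -scalerN sum_merge_neg.
Qed.

(** Now $q$ selects the last entry: $(\tau, g)$ gives the first term and the insertions of $A(x) y$
    into $g$, while $(g, \tau)$ gives the two terms in which $g$ is applied to the first letters. *)
Lemma bracket_mu_l s a G : s != SA -> s != SK ->
  bracket (@pos_l k R) mu_mono [:: tau; Mono s a G] =
  - ((-1) ^+ a.+1 *: partial_l mu A a G).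
Proof.
move=> sA sK; apply/funext => w; rewrite bracket_mu // opprfctE; congr (- _).
have [C eC] : exists C, C = Defs.comp mu_mono by eexists.
rewrite /bracket_summand -eC /pos_l /rev /= /not_K /= summand_neq sK /= !big_ord1 /=.
rewrite !deg_tau deg_mu !degO // addNr mul0r expr0z scale1r addr0 sign_eta.
rewrite /susp /= /id_sV eC comp_mu_unary2 !comp_unary_mu !comp_mu_unary /=.
have ins_size n (b f g : seq R -> R) j : size w != n.+1 -> insertion 2 n j b f w = 0.
  by rewrite /insertion add2n => /negPf ->.
rewrite brace_tau /= => [|sw]; last by rewrite ins_size.
rewrite !scalrfctE; have [sw|sw] := eqVneq (size w) a.+1; last first.
  rewrite !ins_size // brace_size ?addn2 // /partial_l (negPf sw).
  by rewrite (linear0 A) !scaler0 !subr0 addr0.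
rewrite brace_merge // binary_insertion1 // !binary_insertion0 // /partial_l sw eqxx.
rewrite !scalerDr !scalerA -expr2 sqrr_sign scale1r exprS mulN1r mulNr -expr2 sqrr_sign.
by rewrite scaleN1r -sum_merge_neg !scaleNr !scalerN !opprK !addrA.
Qed.

(** An entry of arity 0 is skipped by [pos_r], so [tau] is selected in both orders; each order gives
    two of the four terms. *)
Lemma bracket_mu_K G :
  bracket (@pos_r k R) mu_mono [:: tau; Mono SK 0 G] = partial0 mu A G.
Proof.
apply/funext => w; rewrite bracket_mu ?summand_neqA //.
have [C eC] : exists C, C = Defs.comp mu_mono by eexists.
rewrite /bracket_summand -eC /pos_r /= /not_K /= !summand_neq eqxx /= !big_ord0 !big_ord1 /=.
rewrite deg_tau addNr !mul0r expr0z !scale1r.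
rewrite /susp /= /id_sV eC !comp_unary_mu !comp_mu_unary /=.
have ins_size (b f g : seq R -> R) j : size w != 1 -> insertion 2 0 j b f w = 0.
  by rewrite /insertion => /negPf ->.
rewrite !brace_tau /=; try by move=> sw; rewrite ?scalrfctE ins_size ?scaler0.
rewrite !scalrfctE.
have [sw|sw] := eqVneq (size w) 1; last first.
  rewrite !ins_size // !scaler0 linear0 !subr0 addr0 oppr0.
  by case: w sw {ins_size} => [|x [|y w]].
rewrite !binary_insertion1 // !binary_insertion0 //; case: w sw {ins_size} => [|x [|]] //= _.
rewrite expr1 !scaleN1r linearN !opprD !opprK addrA [LHS]addrC.
by rewrite -!addrA; congr (_ + _); rewrite [LHS]addrC -addrA.
Qed.

End ProductBrackets.

(** * The twisted differential *)

Section TwistedDifferential.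
Variables (k : fieldType) (R : lmodType k).
Variables (mu : {bilinear R -> R -> R}) (A : {linear R -> R}).
Implicit Types (f g G : seq R -> R) (w : seq R).

Local Notation mu_mono := (Mono SA 2 (binary mu)).
Local Notation tau := (Mono SV 1 (unary A)).
Local Notation alpha := (alpha_AvA mu A).

Lemma inj0 s : inj s (0 : seq R -> R) = 0.
Proof. by apply/funext => s'; rewrite injE; case: eqP. Qed.

Lemma injZ s (a : k) f : inj s (a *: f) = a *: inj s f.
Proof. by have := injZD s a f 0; rewrite inj0 !addr0. Qed.

Lemma ident_AvO_ZD n (a : k) (g h : AvO R n) :
  ident_AvO (a *: g + h) = a *: ident_AvO g + ident_AvO h.
Proof.
case: n g h => [|[|n]] g h; [exact: injZD|exact: injZD|].
by rewrite /= !injZD scalerDr addrACA.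
Qed.

Lemma ident_AvO0 n : ident_AvO (0 : AvO R n) = 0.
Proof. by case: n => [|[|n]] /=; rewrite !inj0 ?addr0. Qed.

Lemma ident_AvOZ n (a : k) (g : AvO R n) : ident_AvO (a *: g) = a *: ident_AvO g.
Proof. by have := ident_AvO_ZD a g 0; rewrite ident_AvO0 !addr0. Qed.

Lemma ident_AvO_SA n (g : AvO R n) : ident_AvO g SA = 0.
Proof. by case: n g => [|[|n]] g /=; rewrite !totalE. Qed.

Let muZl a x y : mu (a *: x) y = a *: mu x y.
Proof. exact: linearZl_LR. Qed.
Let muZr a x y : mu x (a *: y) = a *: mu x y.
Proof. exact: linearZr_LR. Qed.
Let AZ a x : A (a *: x) = a *: A x.
Proof. exact: linearZ. Qed.

Let sumZ n (a : k) (c : nat -> k) f (p : nat -> seq R) :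
  \sum_(i < n) c i *: (a *: f) (p i) = a *: \sum_(i < n) c i *: f (p i).
Proof. by rewrite scaler_sumr; apply: eq_bigr => i _; rewrite scalrfctE scalerA mulrC -scalerA. Qed.

Let swapZ (a b : k) (x : R) : b *: (a *: x) = a *: (b *: x).
Proof. by rewrite !scalerA mulrC. Qed.

(** Homogeneity of this map, and of the other pieces of the differential below, moves the factors
    [id_sign] across it. *)
Lemma hochschildZ n (a : k) f : hochschild mu n (a *: f) = a *: hochschild mu n f.
Proof.
apply/funext => w; rewrite -[RHS]/(a *: hochschild mu n f w) /hochschild; case: eqP; last by rewrite scaler0.
move=> _; rewrite (sumZ _ a (fun i => (-1) ^+ i.+1) f (fun i => merge_at mu i w)).
by rewrite !scalrfctE muZr muZl (swapZ a) !scalerDr.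
Qed.

Lemma partial_rZ n (a : k) f : partial_r mu A n (a *: f) = a *: partial_r mu A n f.
Proof.
apply/funext => w; rewrite -[RHS]/(a *: partial_r mu A n f w) /partial_r; case: eqP; last by rewrite scaler0.
move=> _; rewrite (sumZ _ a (fun i => (-1) ^+ i.+1) f (fun i => merge_at _ i w)).
by rewrite !scalrfctE !muZr muZl AZ (swapZ a) !scalerDr scalerN.
Qed.

Lemma partial_lZ n (a : k) f : partial_l mu A n (a *: f) = a *: partial_l mu A n f.
Proof.
apply/funext => w; rewrite -[RHS]/(a *: partial_l mu A n f w) /partial_l; case: eqP; last by rewrite scaler0.
move=> _; rewrite (sumZ _ a (fun i => (-1) ^+ i.+1) f (fun i => merge_at _ i w)).
by rewrite !scalrfctE !muZr !muZl AZ !(swapZ a) !scalerDr.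
Qed.

Lemma partial0Z (a : k) f : partial0 mu A (a *: f) = a *: partial0 mu A f.
Proof.
apply/funext => w; rewrite -[RHS]/(a *: partial0 mu A f w) /partial0.
case: w => [|x [|y w]]; rewrite ?scaler0 //.
by rewrite /= !scalrfctE !muZr !muZl !AZ !scalerDr !scalerN.
Qed.

Lemma partialZ n (a : k) (g : AvO R n) : partial mu A (a *: g) = a *: partial mu A g.
Proof.
case: n g => [|[|n]] g /=; first exact: partial0Z.
  by rewrite partial_rZ partial_lZ.
by rewrite partial_rZ partial_lZ.
Qed.

Lemma PhiZ n (a : k) f : Phi A n (a *: f) = a *: Phi A n f.
Proof.
case: n => [|[|n]] //=.
  by apply/funext => w; rewrite !scalrfctE AZ scalerBr.
by congr pair; apply/funext => w; rewrite /Phi_r /Phi_l !scalrfctE AZ scalerBr.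
Qed.

Lemma l_mixed_mu1 s a G : s != SA ->
  l_mixed [:: mu_mono; tau; Mono s a G] = l_sh mu_mono [:: tau; Mono s a G].
Proof.
move=> sA; rewrite -[[:: _; _; _]]/([::] ++ mu_mono :: [:: tau; Mono s a G]).
rewrite l_mixed_sh ?in_A_SA // /= /in_A /= summand_neq (negPf sA) /=.
by rewrite big_nil mulr0 addr0 expr0z scale1r.
Qed.

(** Moving [mu] past [tau] costs $(-1)^{|\mu||\tau| + 1}$, whose exponent is 2. *)
Lemma l_mixed_mu2 s a G : s != SA ->
  l_mixed [:: tau; mu_mono; Mono s a G] = l_sh mu_mono [:: tau; Mono s a G].
Proof.
move=> sA; rewrite -[[:: _; _; _]]/([:: tau] ++ mu_mono :: [:: Mono s a G]).
rewrite l_mixed_sh ?in_A_SA //= /in_A /= ?summand_neq ?(negPf sA) //=.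
by rewrite big_seq1 deg_tau deg_mu -[RHS]scale1r; congr (_ *: _); exact: (signz_eq k (n := 0)).
Qed.

Lemma l_mixed_tau n f :
  l_mixed (rcons (nseq n tau) (Mono SA n f)) =
  (-1) ^+ n *: l_sh (Mono SA n f) (nseq n tau).
Proof.
rewrite -cats1 l_mixed_sh ?in_A_SA ?has_nseq_tau //= size_nseq addn0 eqxx cats0.
congr (_ *: _); apply: signz_eq; rewrite degA.
have -> : \sum_(g <- nseq n tau) deg g = - n%:Z.
  elim: (n) => [|m IH]; first by rewrite big_nil.
  by rewrite /= big_cons IH deg_tau; lia.
have : odd (absz ((1 - n%:Z) * - n%:Z)) = false.
  by rewrite abszM oddM; apply/negP => /andP[]; lia.
move: (_ * _) => z; lia.
Qed.

Lemma l_sh_tau n f : hom n.+1 f ->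
  l_sh (Mono SA n.+1 f) (nseq n.+1 tau) =
  ((n.+1`!)%:R * (-1) ^+ 'C(n.+1, 2)) *: ident_AvO (Phi A n.+1 f).
Proof.
move=> hf; rewrite /l_sh all_nseq orbC /in_low inE /= summand_neq inE eqxx /= count_nseq.
rewrite /= eqxx mul1n bracket_tau_r // bracket_tau_l //.
case: n hf => [|n] hf /=; last by rewrite !injZ scalerDr.
(* In arity 1, [map_tail] fixes a one-letter word, so [Phi_r] is $\Phi^1$. *)
rewrite injZ; congr (_ *: inj _ _); apply/funext => w; rewrite /Phi_r.
case: w => [|x [|y w]] //; last by rewrite !(hom_size hf).
Qed.

(** For arity 0 the two brackets have a common value in [SV]; for arity 1 both arguments lie in [SV]
    and both brackets appear; from arity 2 on, each of [Sr] and [Sl] yields its own bracket. *)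
Lemma l_sh_mu n (g : AvO R n) :
  \sum_(s | occurs s (1 - n.+1%:Z) && (s != SA))
     l_sh mu_mono [:: tau; Mono s n (ident_AvO g s)] =
  (-1) ^+ n *: ident_AvO (partial mu A g).
Proof.
rewrite big_mkcond big_summand /= eqxx !summand_neq /= andbF add0r !andbT.
rewrite !occurs_AvOS ?summand_neqA //.
case: n g => [|[|n]] g /=; rewrite ?addr0 ?add0r.
- rewrite /l_sh /= /in_low /= !inE /= !summand_neq !eqxx /=.
  by rewrite !totalE bracket_mu_K scale1r.
- rewrite /l_sh /= /in_low /= !inE /= !summand_neq !eqxx /=.
  rewrite !totalE bracket_mu_r ?bracket_mu_l ?summand_neq //.
  by rewrite -!scaleNr !injZ -scalerDr exprSr expr1 mulN1r opprK.
rewrite /l_sh /= /in_low /in_r /in_l /= !inE /= !summand_neq !eqxx /=.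
rewrite !totalE bracket_mu_r ?bracket_mu_l ?summand_neq //.
by rewrite -!scaleNr !injZ -scalerDr [_ ^+ n.+3]exprS mulN1r opprK.
Qed.

Lemma sums_toD (L : lmodType k) (u v : nat -> L) a b :
  sums_to u a -> sums_to v b -> sums_to (fun i => u i + v i) (a + b).
Proof.
move=> [n hn] [m hm]; exists (maxn n m) => p; rewrite geq_max => /andP[np mp].
by rewrite big_split /= hn // hm.
Qed.

Lemma sums_to_single (L : lmodType k) j (a : L) :
  sums_to (fun i => if i == j then a else 0) a.
Proof.
exists j.+1 => m jm; rewrite (bigD1 (Ordinal jm)) //= eqxx big1 ?addr0 // => i.
by rewrite -val_eqE /= => /negPf ->.
Qed.

Lemma sums_to0 (L : lmodType k) (u : nat -> L) : (forall i, u i = 0) -> sums_to u 0.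
Proof. by move=> u0; exists 0%N => m _; rewrite big1. Qed.

Lemma twist_sign1 i (d : int) (X : total R) :
  twist_sign i [:: (d, X)] = (i + 'C(i.+1, 2))%N%:Z.
Proof. by rewrite /twist_sign /= big_geq // addr0 muln1. Qed.

(** The sequence is a sum of four sequences supported at 0, 1, 2 and [n], so coincidences for small
    [n] simply add up. The last one is set to 0 for [n] equal to 0, where index 0 is already
    counted. *)
Lemma sums_alpha n (X : total R) (c : nat -> k) :
  sums_to (fun i => c i *: l_AvA R (nseq i (-1, alpha) ++ [:: (1 - n%:Z, X)]))
    (c 0%N *: (if n == 0%N then inj SK (X SA) else 0)
     + c 1%N *: inj SA (gerstenhaber mu_mono (Mono SA n (X SA)))
     + c 2 *: (\sum_(s | occurs s (1 - n%:Z) && (s != SA))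
         (l_mixed [:: mu_mono; tau; Mono s n.-1 (X s)]
          + l_mixed [:: tau; mu_mono; Mono s n.-1 (X s)]))
     + c n *: (if n == 0%N then 0 else l_mixed (rcons (nseq n tau) (Mono SA n (X SA))))).
Proof.
set t0 := _ *: (if _ then inj _ _ else _); set t1 := _ *: inj SA _.
set t2 := _ *: \sum_(_ | _) _; set tn := _ *: (if _ then 0 else _).
have := sums_toD (sums_toD (sums_toD (sums_to_single 0 t0) (sums_to_single 1 t1))
  (sums_to_single 2 t2)) (sums_to_single n tn).
congr sums_to; apply/funext => -[|[|[|i]]] /=; rewrite ?addr0 ?add0r /t0 /t1 /t2 /tn {t0 t1 t2 tn}.
- by rewrite l_AvA_alpha0; case: n => [|n] /=; rewrite ?scaler0 ?addr0.
- rewrite l_AvA_alpha1 scalerDr; congr (_ + _).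
  by case: n => [|[|n]] /=; rewrite ?scaler0.
- rewrite l_AvA_alpha2 scalerDr addrC; congr (_ + _).
  by case: n => [|[|[|n]]] /=; rewrite ?scaler0.
rewrite (@l_AvA_alpha3 _ _ mu A n X i.+3) //; have [e|e] := eqVneq i.+3 n; last by rewrite scaler0.
by rewrite -e.
Qed.

Lemma sum_l_mixed_mu n (g : AvO R n) :
  \sum_(s | occurs s (1 - n.+1%:Z) && (s != SA))
     (l_mixed [:: mu_mono; tau; Mono s n (ident_AvO g s)]
      + l_mixed [:: tau; mu_mono; Mono s n (ident_AvO g s)]) =
  (2%:R * (-1) ^+ n) *: ident_AvO (partial mu A g).
Proof.
rewrite -scalerA -l_sh_mu scaler_sumr; apply: eq_bigr => s /andP[_ sA].
by rewrite l_mixed_mu1 // l_mixed_mu2 // scaler_nat mulr2n.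
Qed.

(** The successive binomials in [id_sign] differ by $n+1$. This factor is the discrepancy between
    $[\mu, f]$ and the Hochschild differential. *)
Lemma id_signS n : id_sign k n.+1 = (-1) ^+ n.+1 * id_sign k n.
Proof. by rewrite /id_sign -exprD; apply: signr_odd_eq; rewrite binS bin1; lia. Qed.

(** The coefficients $1/n!$ and $1/2!$ of the twist cancel the $n!$ of [l_sh_tau] and the 2 of
    [sum_l_mixed_mu]. The assumption on the characteristic makes both invertible; the signs are then
    compared component by component. *)
Lemma twisted_ident n (x : AvA R n) : C_AvA R n x -> ((maxn n 2)`!)%:R != 0 :> k ->
  twisted (l_AvA R) alpha [:: (1 - n%:Z, ident n x)] (ident n.+1 (d_AvA mu A n x)).
Proof.
move=> hx char; have [n0 two0] : (n`!)%:R != 0 :> k /\ 2%:R != 0 :> k.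
  have ndvd m : (m <= maxn n 2)%N -> (m`!)%:R != 0 :> k.
    move=> /bin_fact e; move: char; rewrite -e !natrM; apply: contra_neq => ->.
    by rewrite mul0r mulr0.
  by split; [exact/ndvd/leq_maxl|exact: (ndvd 2%N (leq_maxr _ _))].
rewrite /twisted; have := sums_alpha n (ident n x)
  (fun i => (i`!)%:R^-1 * (-1) ^ twist_sign i [:: (1 - n%:Z, ident n x)]).
congr sums_to; rewrite !twist_sign1 /= !gerstenhaber_hochschild.
have c1 : (1`!)%:R^-1 * (-1) ^ (1 + 'C(2, 2))%N = 1 :> k.
  by rewrite invr1 mul1r; exact: (signz_eq k (n := 0)).
have c2 : (2`!)%:R^-1 * (-1) ^ (2 + 'C(3, 2))%N = - 2%:R^-1 :> k.
  by rewrite (signz_eq k (n := 1)) // expr1 mulrN1.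
rewrite c1 c2 scale1r.
case: n x hx char n0 => [|n] x hx char n0.
  rewrite /= !totalE expr0z mulr1 invr1 scale1r.
  rewrite big1 => [|s /andP[os sA]]; last by rewrite occurs_AvO0 in os.
  by rewrite scaler0 addr0 hochschildZ !injZ scalerA -id_signS addrC.
move: x hx => [f g] [hf hg].
have XA : ident n.+1 (f, g) SA = id_sign k n.+1 *: f.
  by rewrite /= totalD !totalZ injE eqxx ident_AvO_SA scaler0 addr0.
have XO s : s != SA -> ident n.+1 (f, g) s = ident_AvO (id_sign k n *: g) s.
  by move=> sA; rewrite ident_AvOZ /= totalD !totalZ injE (negPf sA) scaler0 add0r.
rewrite XA [\sum_(s | _) _](_ : _ = (2%:R * (-1) ^+ n) *:
    ident_AvO (partial mu A (id_sign k n *: g))); last first.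
  by rewrite -sum_l_mixed_mu; apply: eq_bigr => s /andP[_ sA]; rewrite XO.
rewrite (_ : (n.+1 == 0)%N = false) // scaler0 add0r l_mixed_tau l_sh_tau; last exact: homZ.
rewrite -[RHS]/(id_sign k n.+2 *: inj SA (hochschild mu n.+1 f) + id_sign k n.+1 *:
  ident_AvO ((-1) ^+ n.+1 *: Phi A n.+1 f + partial mu A g)).
rewrite partialZ PhiZ !ident_AvOZ ident_AvO_ZD hochschildZ !injZ scalerDr !scalerA.
rewrite -addrA [X in _ + X]addrC; congr (_ *: _ + (_ *: _ + _ *: _)).
- by rewrite (id_signS n.+1).
(* The exponents $n+1+\binom{n+2}{2}$ of the twist, $n+1$ of [l_mixed_tau] and $\binom{n+1}{2}$ of
   [l_sh_tau] add up to $n+1$ modulo 2. *)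
- rewrite (signz_eq k (n := n.+1 + 'C(n.+2, 2))) //.
  rewrite mulrC; congr (_ * _).
  rewrite [X in _ * X]mulrCA mulrACA mulVf // mul1r -!exprD.
  by apply: signr_odd_eq; rewrite [in 'C(n.+2, 2)]binS bin1; lia.
(* Here $-\frac12 \cdot 2(-1)^n = (-1)^{n+1}$ is the recursion factor of [id_sign]. *)
by rewrite id_signS exprS mulN1r !mulNr mulrA mulVf // mul1r.
Qed.

End TwistedDifferential.

(** * The Maurer-Cartan equation *)

Section MaurerCartan.
Variables (k : fieldType) (R : lmodType k).
Variables (mu : {bilinear R -> R -> R}) (A : {linear R -> R}).
Hypothesis hRA : averaging_algebra mu A.

Local Notation alpha := (alpha_AvA mu A).

Lemma hochschild_mu : hochschild mu 2 (binary mu) = 0.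
Proof.
have [muA _ _] := hRA; apply/funext => -[|x [|y [|z [|t w]]]] //.
rewrite /hochschild /= !big_ord_recl big_ord0 /merge_at /= muA !exprS expr0.
by rewrite !(mulr1, mulN1r, opprK) !scaleN1r scale1r addr0 addNr addr0 subrr.
Qed.

Lemma partial_A : partial mu A (unary A : AvO R 1) = 0.
Proof.
have [_ AA1 AA2] := hRA.
congr pair; apply/funext => -[|x [|y [|z w]]] //; rewrite /partial_r /partial_l /=.
  rewrite big_ord1 /merge_at /= -AA1 !exprS expr0.
  rewrite !(mulr1, mulN1r, opprK) scaleN1r scale1r.
  by rewrite subrr add0r addNr.
rewrite big_ord1 /merge_at /= -AA2 -AA1 !exprS expr0.
rewrite !(mulr1, mulN1r, opprK) !scaleN1r scale1r.
by rewrite subrr add0r subrr.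
Qed.

Lemma Phi_mu : Phi A 2 (binary mu) = 0.
Proof.
have [_ AA1 AA2] := hRA.
congr pair; apply/funext => -[|x [|y [|z w]]]; rewrite /Phi_r /Phi_l /= ?(linear0 A) ?subrr //.
- by rewrite AA1 subrr.
- by rewrite AA1 AA2 subrr.
- by case: w => [|t w] /=; rewrite (linear0 A) subrr.
Qed.

Lemma alpha_ident : alpha = ident 2 (binary mu, unary A : AvO R 1).
Proof.
by rewrite /ident /id_sign /= !(signr_odd_eq _ (n := 0)) // !scale1r.
Qed.

Lemma alpha_C_AvA : C_AvA R 2 (binary mu, unary A : AvO R 1).
Proof.
split; last exact: hom_unary.
by apply: hom_binary => a x y z; [exact: linearPl|exact: linearPr].
Qed.

(** The last copy of alpha is read as the argument [X] with [n] equal to 2. Each bracket vanishes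
    separately, so the Maurer-Cartan sum is zero term by term in every characteristic. *)
Lemma l_AvA_alpha i : l_AvA R (nseq i.+1 (-1, alpha)) = 0.
Proof.
have -> : nseq i.+1 (-1, alpha) = nseq i (-1, alpha) ++ [:: (1 - 2%:Z, alpha)].
  by rewrite -addn1 nseqD.
have aA : alpha SA = binary mu by rewrite /alpha_AvA !totalE.
have hmu : hom 2 (binary mu) by case: alpha_C_AvA.
have tau2 : l_mixed [:: Mono SV 1 (unary A); Mono SV 1 (unary A); Mono SA 2 (binary mu)] = 0.
  rewrite -[[:: _; _; _]]/(rcons (nseq 2 (Mono SV 1 (unary A))) (Mono SA 2 (binary mu))).
  by rewrite l_mixed_tau l_sh_tau // Phi_mu ident_AvO0 !scaler0.
case: i => [|[|[|i]]].
- exact: l_AvA_alpha0.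
- rewrite l_AvA_alpha1 aA gerstenhaber_hochschild hochschild_mu scaler0 addr0.
  exact: inj0.
- rewrite l_AvA_alpha2 aA [X in X + _]tau2 add0r.
  transitivity ((2%:R * (-1) ^+ 1) *: ident_AvO (partial mu A (unary A : AvO R 1))).
    rewrite -sum_l_mixed_mu; apply: eq_bigr => s /andP[_ /negPf sA].
    by rewrite /alpha_AvA totalD injE sA add0r.
  by rewrite partial_A ident_AvO0 scaler0.
exact: l_AvA_alpha3.
Qed.

Lemma maurer_cartan_alpha : maurer_cartan (grade R) (l_AvA R) alpha.
Proof.
split; first by rewrite alpha_ident; exact: (ident_grade alpha_C_AvA).
by apply: sums_to0 => -[|i] //=; rewrite l_AvA_alpha scaler0.
Qed.

End MaurerCartan.

Theorem proposition6p7 (k : fieldType) (R : lmodType k)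
    (mu : {bilinear R -> R -> R}) (A : {linear R -> R})
    (hRA : averaging_algebra mu A) :
  let alpha := alpha_AvA mu A in
  [/\ maurer_cartan (grade R) (l_AvA R) alpha,
      (forall n : nat, linear (ident (R := R) n) /\
         set_bij (C_AvA R n) (grade R (1 - n%:Z)) (ident n)),
      (forall d : int, 1 < d -> grade R d = [set 0]) &
      (forall (n : nat) (x : AvA R n), C_AvA R n x ->
         C_AvA R n.+1 (d_AvA mu A n x) /\
         (((maxn n 2)`!)%:R != 0 :> k ->
          twisted (l_AvA R) alpha [:: (1 - n%:Z, ident n x)]
            (ident n.+1 (d_AvA mu A n x))))].
Proof.
split.
- exact: maurer_cartan_alpha.
- by move=> n; split; [exact: ident_linear|exact: ident_bij].
- exact: grade_gt1.
by move=> n x hx; split; [exact: C_AvA_d|exact: twisted_ident].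
Qed.
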